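(* Let $\mu$ be a computable non-atomic probability measure on the Cantor space $\Omega=\{0,1\}^{\mathbb{N}}$. Then for every constant $c$ there exists a sequence $\omega\in\Omega$ such that \[ \mathbf{d}^{A}_\mu(\omega) < \mathbf{d}^{P}_\mu(\omega) - \log\mathbf{d}^{P}_\mu(\omega) - c . \]
   Context: $\Omega$ is the set of infinite binary sequences; for a finite binary string $x$, $[x]$ denotes the set of sequences extending $x$ (an interval); $\omega_{1\ldots n}$ is the length-$n$ prefix of $\omega$; $\mathbb{B}^*$ is the set of finite binary strings; $\log$ is binary logarithm. A measure $\mu$ on $\Omega$ is computable if there is an algorithm that, given a string $x$ and a rational $\varepsilon>0$, outputs an $\varepsilon$-approximation of $\mu([x])$. It is non-atomic if $\mu(\{\omega\})=0$ for every $\omega$. A function $t:\Omega\to[0,\infty]$ is lower semicomputable if there is an algorithm that, given rational $r$, enumerates a set of intervals whose union is $\{\omega: t(\omega)>r\}$. It is probability bounded (w.r.t. $\mu$) if $\mu\{\omega: t(\omega)>c\}\le 1/c$ for all rationals $c>0$. There exists a maximal (up to a multiplicative constant) lower semicomputable probability bounded function $\mathbf{t}^P_\mu$ (i.e. for every lower semicomputable probability bounded $t$ there is $C$ with $t\le C\,\mathbf{t}^P_\mu$); set $\mathbf{d}^P_\mu=\log\mathbf{t}^P_\mu$ (equivalently, the randomness deficiency with respect to a universal Martin-Löf test). A function $f:\mathbb{B}^*\to[0,\infty)$ is lower semicomputable if it is the pointwise limit of a computable increasing sequence of finitely supported rational-valued functions. A continuous lower semicomputable semimeasure is a lower semicomputable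 $a:\mathbb{B}^*\to[0,\infty)$ with $\sum_{x\in S}a(x)\le 1$ for every prefix-free $S\subseteq\mathbb{B}^*$. Fix a universal such $\mathbf{a}$ (for every such $a$ there is $C$ with $a\le C\,\mathbf{a}$), and let $KA(x)=-\log\mathbf{a}(x)$. Define $\mathbf{d}^{A}_\mu(\omega)=\sup_n\{-\log\mu([\omega_{1\ldots n}])-KA(\omega_{1\ldots n})\}$. *)

(* Defs.v *)
(* Library: MathComp + MathComp-Analysis. *)
From HB Require Import structures.
From mathcomp Require Import all_boot all_order all_algebra.
From mathcomp Require Import all_classical all_reals all_analysis.
Set Implicit Arguments.
Unset Strict Implicit.
Unset Printing Implicit Defensive.
Import Order.TTheory GRing.Theory Num.Theory.
Import numFieldNormedType.Exports.
Local Open Scope classical_set_scope.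
Local Open Scope ring_scope.

(* The total computable functions of several natural arguments: Kleene's general
   recursive functions, with minimization applied to regular functions only. *)
Inductive recursive : forall n : nat, (n.-tuple nat -> nat) -> Prop :=
| rec_zero n : recursive (fun _ : n.-tuple nat => 0%N)
| rec_succ : recursive (fun v : 1.-tuple nat => (thead v).+1)
| rec_proj n (i : 'I_n) : recursive (fun v : n.-tuple nat => tnth v i)
| rec_comp m n (f : m.-tuple nat -> nat) (g : 'I_m -> n.-tuple nat -> nat) :
    recursive f -> (forall i, recursive (g i)) ->
    recursive (fun v => f [tuple g i v | i < m])
| rec_prim n (f : n.-tuple nat -> nat) (g : n.+2.-tuple nat -> nat)
    (h : n.+1.-tuple nat -> nat) :
    recursive f -> recursive g ->
    (forall v : n.-tuple nat, h [tuple of 0%N :: v] = f v) ->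
    (forall k (v : n.-tuple nat), h [tuple of k.+1 :: v] =
                 g [tuple of k :: h [tuple of k :: v] :: v]) ->
    recursive h
| rec_min n (f : n.+1.-tuple nat -> nat) (h : n.-tuple nat -> nat) :
    recursive f ->
    (forall v : n.-tuple nat, f [tuple of h v :: v] = 0%N) ->
    (forall (v : n.-tuple nat) k, (k < h v)%N -> f [tuple of k :: v] <> 0%N) ->
    recursive h.

(* Algorithms receive and return rationals as triples of natural numbers; a
   rational has many such codes. *)
Definition ratn (a b d : nat) : rat := (a%:R - b%:R) / d.+1%:R.

Definition recursive_rat n (f : n.-tuple nat -> rat) : Prop :=
  exists p q d : n.-tuple nat -> nat,
    [/\ recursive p, recursive q, recursive d &
        forall v, f v = ratn (p v) (q v) (d v)].

(* Bijective base-2 numeration: a bijection between strings and nat. *)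
Fixpoint str_code (x : seq bool) : nat :=
  if x is b :: y then (2 * str_code y + 1 + b)%N else 0%N.

Definition cyl (x : seq bool) : set (nat -> bool) :=
  [set w | mkseq w (size x) = x].

(* The Cantor space with its Borel sigma-algebra, generated by the countably
   many intervals (a base of the product topology). *)
Definition Omega := g_sigma_algebraType (range cyl).

Section Deficiencies.
Variable R : realType.
Implicit Types (mu : probability Omega R) (t : Omega -> \bar R)
  (a : seq bool -> R).
Local Open Scope ereal_scope.

Definition elog2 (x : \bar R) : \bar R := lne x * ((ln 2)^-1)%:E.

Definition computable_measure mu : Prop :=
  exists2 q : 3.-tuple nat -> rat, recursive_rat q &
    forall (x : seq bool) (e d : nat),
      `| mu (cyl x) - (ratr (q [tuple str_code x; e; d]))%:E |
        <= (ratr (ratn e.+1 0 d))%:E.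

Definition non_atomic mu : Prop := forall w : Omega, mu [set w] = 0.

(* The enumerating algorithm is a total function of the rational r and the step
   number n; the value 0 means that no interval is listed at step n. *)
Definition lsc_fun t : Prop :=
  exists2 e : 4.-tuple nat -> nat, recursive e &
    forall p q d : nat,
      [set w | (ratr (ratn p q d))%:E < t w] =
      \bigcup_(x in [set x : seq bool |
          exists n, e [tuple p; q; d; n] = (str_code x).+1]) cyl x.

Definition probability_bounded mu t : Prop :=
  forall c : rat, (0 < c)%R ->
    mu [set w | (ratr c)%:E < t w] <= (ratr c^-1)%:E.

Definition pb_test mu t : Prop :=
  [/\ forall w, 0 <= t w, lsc_fun t & probability_bounded mu t].

Definition maximal_pb_test mu t : Prop :=
  pb_test mu t /\
  forall t', pb_test mu t' ->
    exists2 C : R, (0 < C)%R & forall w, t' w <= C%:E * t w.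

(* The bound N on supports makes each s_i a computable finite object. *)
Definition lsc_str a : Prop :=
  exists (s : nat -> seq bool -> rat) (N : 1.-tuple nat -> nat)
         (q : 2.-tuple nat -> rat),
    [/\ recursive_rat q /\ recursive N,
        forall i x, s i x = q [tuple i; str_code x],
        forall i x, (N [tuple i] <= size x)%N -> s i x = 0%R,
        forall i x, (s i x <= s i.+1 x)%R &
        forall x, (fun i => ratr (s i x) : R) @ \oo --> a x].

Definition prefix_free (S : set (seq bool)) : Prop :=
  forall x y, S x -> S y -> prefix x y -> x = y.

Definition lsc_semimeasure a : Prop :=
  [/\ forall x, (0 <= a x)%R, lsc_str a &
      forall S, prefix_free S -> \esum_(x in S) (a x)%:E <= 1].

Definition universal_semimeasure a : Prop :=
  lsc_semimeasure a /\
  forall a', lsc_semimeasure a' ->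
    exists2 C : R, (0 < C)%R & forall x, (a' x <= C * a x)%R.

Definition KA a (x : seq bool) : \bar R := - elog2 (a x)%:E.

Definition dP t (w : Omega) : \bar R := elog2 (t w).

Definition dA mu a (w : Omega) : \bar R :=
  ereal_sup [set - elog2 (mu (cyl (mkseq w n))) - KA a (mkseq w n) | n in setT].

End Deficiencies.

(* Main.v *)
(* For a sequence of clopen sets U_k of measure about 2^-k, given effectively,
   the function 2^k / 4 on U_k is a probability bounded test, so t^P exceeds
   2^k / C on U_k. If the theorem failed, almost every w in U_k would have a
   prefix y with a(y) >= lam_k mu(y), where lam_k = kappa 2^k / k. Choose U_k to
   be nearly independent of the prefixes of length lev k that determine
   U_0, ..., U_(k-1), and let A_k be the part of U_k outside the earlier sets.
   Let g = sum_k lam_k 1_(A_k), over a range of large k for which sum_k kappa / k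
   lies between 8 and 8 + kappa. For w in A_k the integral of g over [y] is at
   most 2 a(y): the terms j <= k contribute at most lam_k mu(y), by disjointness,
   and for j > k either [y] is already contained in U_k, so that A_j misses it,
   or A_j has density at most 2 * 2^-j in [y]. The shortest such prefixes y form
   a prefix-free set, hence the integral of g is at most 2; but it is at least
   a quarter of sum_k kappa / k. *)
Require Import Defs.
From HB Require Import structures.
From mathcomp Require Import all_boot all_order all_algebra.
From mathcomp Require Import all_classical all_reals all_analysis.
From mathcomp Require Import ring lra zify.
Set Implicit Arguments.
Unset Strict Implicit.
Unset Printing Implicit Defensive.
Import Order.TTheory GRing.Theory Num.Theory.
Import numFieldNormedType.Exports.
Local Open Scope classical_set_scope.

(** * Recursive functions *)

Local Open Scope nat_scope.

Lemma thead_cons n (x : nat) (v : n.-tuple nat) : thead [tuple of x :: v] = x.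
Proof. exact: theadE. Qed.

Lemma behead_cons n (x : nat) (v : n.-tuple nat) :
  behead_tuple [tuple of x :: v] = v.
Proof. exact: val_inj. Qed.

Lemma recursive_eq n (f g : n.-tuple nat -> nat) :
  recursive g -> f =1 g -> recursive f.
Proof. by move=> gR fg; rewrite (_ : f = g) //; exact/funext. Qed.

Lemma recursive_weaken n (f : n.-tuple nat -> nat) :
  recursive f -> recursive (fun v : n.+1.-tuple nat => f (behead_tuple v)).
Proof.
move=> fR.
apply: recursive_eq
  (rec_comp fR (fun i : 'I_n => rec_proj (lift ord0 i))) _ => v.
congr f; apply: eq_from_tnth => i.
by rewrite tnth_mktuple tnth_behead; congr tnth; apply: val_inj;
  rewrite /= inordK // ltnS ltn_ord.
Qed.

Lemma recursive_subst n (f : n.+1.-tuple nat -> nat) (b : n.-tuple nat -> nat) :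
  recursive f -> recursive b ->
  recursive (fun v : n.-tuple nat => f [tuple of b v :: v]).
Proof.
move=> fR bR.
pose g (i : 'I_n.+1) (v : n.-tuple nat) :=
  if unlift ord0 i is Some j then tnth v j else b v.
have gR i : recursive (g i).
  by rewrite /g; case: unliftP => [j|] _ //; exact: rec_proj.
apply: recursive_eq (rec_comp fR gR) _ => v; congr f.
apply: eq_from_tnth => i; rewrite tnth_mktuple /g.
case: unliftP => [j|] ->; last exact: tnth0.
by rewrite tnthS.
Qed.

Lemma recursive_thead n : recursive (fun v : n.+1.-tuple nat => thead v).
Proof. exact: rec_proj. Qed.

Lemma recursive_succ n (f : n.-tuple nat -> nat) :
  recursive f -> recursive (fun v => (f v).+1).
Proof.
move=> fR; apply: recursive_eq (rec_comp rec_succ (fun _ : 'I_1 => fR)) _ => v.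
by rewrite /thead tnth_mktuple.
Qed.

Lemma recursive_const n (c : nat) : recursive (fun _ : n.-tuple nat => c).
Proof. by elim: c => [|c IH]; [exact: rec_zero | exact: recursive_succ]. Qed.

(** With [nat_rect] the equations required by [rec_prim] hold by computation, so the closure lemmas
    below only have to supply a step function. *)
Lemma recursive_nat_rect n (f b : n.-tuple nat -> nat)
    (g : nat -> nat -> n.-tuple nat -> nat) :
  recursive f -> recursive b ->
  recursive (fun u : n.+2.-tuple nat =>
    g (thead u) (thead (behead_tuple u)) (behead_tuple (behead_tuple u))) ->
  recursive (fun v =>
    nat_rect (fun=> nat) (f v) (fun k acc => g k acc v) (b v)).
Proof.
move=> fR bR gR.
pose h (u : n.+1.-tuple nat) := nat_rect (fun=> nat) (f (behead_tuple u))
  (fun k acc => g k acc (behead_tuple u)) (thead u).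
have hR : recursive h.
  apply: rec_prim fR gR _ _ => [v|k v].
    by rewrite /h thead_cons behead_cons.
  by rewrite /h !thead_cons !behead_cons !thead_cons.
by apply: recursive_eq (recursive_subst hR bR) _ => v;
  rewrite /h thead_cons behead_cons.
Qed.

Lemma recursive_comp1 n (f : nat -> nat) (a : n.-tuple nat -> nat) :
  recursive (fun v : 1.-tuple nat => f (thead v)) ->
  recursive a -> recursive (fun v => f (a v)).
Proof.
move=> fR aR; apply: recursive_eq (rec_comp fR (fun _ : 'I_1 => aR)) _ => v.
by rewrite /thead tnth_mktuple.
Qed.

Lemma recursive_comp2 n (f : nat -> nat -> nat) (a b : n.-tuple nat -> nat) :
  recursive (fun v : 2.-tuple nat => f (thead v) (thead (behead_tuple v))) ->
  recursive a -> recursive b -> recursive (fun v => f (a v) (b v)).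
Proof.
move=> fR aR bR.
pose g (i : 'I_2) := if i == 0 :> nat then a else b.
have gR i : recursive (g i) by rewrite /g; case: ifP.
apply: recursive_eq (rec_comp fR gR) _ => v.
by rewrite /thead !tnth_behead !tnth_mktuple /g /= !inordK.
Qed.

Lemma recursive_comp3 n (f : nat -> nat -> nat -> nat)
    (a b c : n.-tuple nat -> nat) :
  recursive (fun v : 3.-tuple nat => f (thead v) (thead (behead_tuple v))
    (thead (behead_tuple (behead_tuple v)))) ->
  recursive a -> recursive b -> recursive c ->
  recursive (fun v => f (a v) (b v) (c v)).
Proof.
move=> fR aR bR cR.
pose g (i : 'I_3) := if i == 0 :> nat then a else if i == 1 :> nat then b else c.
have gR i : recursive (g i) by rewrite /g; case: ifP => _ //; case: ifP.
apply: recursive_eq (rec_comp fR gR) _ => v.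
by rewrite /thead !tnth_behead !tnth_mktuple /g /= !inordK.
Qed.

Lemma recursive_pred n (a : n.-tuple nat -> nat) :
  recursive a -> recursive (fun v => (a v).-1).
Proof.
move=> aR.
have R0 := @recursive_nat_rect n (fun=> 0) a (fun k _ _ => k)
  (recursive_const _ _) aR (@recursive_thead _).
by apply: recursive_eq R0 _ => v; case: (a v).
Qed.

Lemma recursive_add n (a b : n.-tuple nat -> nat) :
  recursive a -> recursive b -> recursive (fun v => a v + b v).
Proof.
move=> aR bR.
have R0 := @recursive_nat_rect n b a (fun _ acc _ => acc.+1) bR aR
  (recursive_succ (recursive_weaken (@recursive_thead _))).
by apply: recursive_eq R0 _ => v; elim: (a v) => //= m <-; rewrite addSn.
Qed.

Lemma recursive_sub n (a b : n.-tuple nat -> nat) :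
  recursive a -> recursive b -> recursive (fun v => a v - b v).
Proof.
move=> aR bR.
have R0 := @recursive_nat_rect n a b (fun _ acc _ => acc.-1) aR bR
  (recursive_pred (recursive_weaken (@recursive_thead _))).
by apply: recursive_eq R0 _ => v; elim: (b v) => [|m /= <-];
  rewrite ?subn0 ?subnS.
Qed.

Lemma recursive_sum n (b : n.-tuple nat -> nat) (F : nat -> n.-tuple nat -> nat) :
  recursive b ->
  recursive (fun u : n.+1.-tuple nat => F (thead u) (behead_tuple u)) ->
  recursive (fun v => \sum_(i < b v) F i v).
Proof.
move=> bR FR.
have sR : recursive (fun u : n.+2.-tuple nat =>
    thead (behead_tuple u) + F (thead u) (behead_tuple (behead_tuple u))).
  apply: recursive_add; first exact: recursive_weaken (@recursive_thead _).
  pose g (i : 'I_n.+1) (u : n.+2.-tuple nat) :=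
    if unlift ord0 i is Some j then tnth (behead_tuple (behead_tuple u)) j
    else thead u.
  have gR i : recursive (g i).
    rewrite /g; case: unliftP => [j|] _; last exact: rec_proj.
    exact: recursive_weaken (recursive_weaken (rec_proj j)).
  apply: recursive_eq (rec_comp FR gR) _ => u; congr F.
    by rewrite /thead tnth_mktuple /g unlift_none.
  apply: eq_from_tnth => i; rewrite [RHS]tnth_behead tnth_mktuple /g.
  suff -> : inord i.+1 = lift ord0 i by rewrite liftK.
  by apply: val_inj; rewrite /= inordK // ltnS ltn_ord.
have R0 := @recursive_nat_rect n (fun=> 0) b (fun k acc v => acc + F k v)
  (recursive_const _ _) bR sR.
by apply: recursive_eq R0 _ => v; elim: (b v) => [|m /= <-];
  rewrite ?big_ord0 ?big_ord_recr.
Qed.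

Lemma recursive_mul n (a b : n.-tuple nat -> nat) :
  recursive a -> recursive b -> recursive (fun v => a v * b v).
Proof.
move=> aR bR; apply: recursive_eq (recursive_sum aR (F := fun=> b) _) _.
  exact: recursive_weaken.
by move=> v; rewrite sum_nat_const card_ord.
Qed.

Lemma recursive_exp2 n (a : n.-tuple nat -> nat) :
  recursive a -> recursive (fun v => 2 ^ a v).
Proof.
move=> aR.
have R0 := @recursive_nat_rect n (fun=> 1) a (fun _ acc _ => 2 * acc)
  (recursive_const _ _) aR
  (recursive_mul (recursive_const _ _) (recursive_weaken (@recursive_thead _))).
by apply: recursive_eq R0 _ => v; elim: (a v) => //= m <-; rewrite expnS.
Qed.

Lemma recursive_leq n (a b : n.-tuple nat -> nat) :
  recursive a -> recursive b -> recursive (fun v => a v <= b v : nat).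
Proof.
move=> aR bR; apply: recursive_eq (recursive_sub (recursive_const n 1)
  (recursive_sub aR bR)) _ => v.
by rewrite -subn_eq0; case: (_ - _).
Qed.

Lemma recursive_and n (a b : n.-tuple nat -> bool) :
  recursive (fun v => a v : nat) -> recursive (fun v => b v : nat) ->
  recursive (fun v => a v && b v : nat).
Proof.
by move=> aR bR; apply: recursive_eq (recursive_mul aR bR) _ => v; rewrite mulnb.
Qed.

Lemma recursive_or n (a b : n.-tuple nat -> bool) :
  recursive (fun v => a v : nat) -> recursive (fun v => b v : nat) ->
  recursive (fun v => a v || b v : nat).
Proof.
move=> aR bR; apply: recursive_eq (recursive_sub (recursive_add aR bR)
  (recursive_mul aR bR)) _ => v.
by case: (a v); case: (b v).
Qed.

Lemma recursive_eqn n (a b : n.-tuple nat -> nat) :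
  recursive a -> recursive b -> recursive (fun v => a v == b v : nat).
Proof.
move=> aR bR; apply: recursive_eq (recursive_and (recursive_leq aR bR)
  (recursive_leq bR aR)) _ => v.
by rewrite eqn_leq.
Qed.

Lemma recursive_exists n (b : n.-tuple nat -> nat)
    (P : nat -> n.-tuple nat -> bool) :
  recursive b ->
  recursive (fun u : n.+1.-tuple nat => P (thead u) (behead_tuple u) : nat) ->
  recursive (fun v => [exists i : 'I_(b v), P i v] : nat).
Proof.
move=> bR PR.
apply: recursive_eq (recursive_leq (recursive_const n 1)
  (recursive_sum (F := fun i v => P i v) bR PR)) _ => v.
congr nat_of_bool; rewrite lt0n sum_nat_eq0 negb_forall.
apply: eq_existsb => i; by rewrite implyTb; case: (P i v).
Qed.

(** Bounded sums are already known to be recursive; counting the positive multiples of [b] up to [a]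
    therefore makes division recursive. *)
Lemma divn_sum (a b : nat) : 0 < b -> a %/ b = \sum_(i < a) (i.+1 * b <= a).
Proof.
move=> b0.
under eq_bigr do rewrite -leq_divRL //.
rewrite -(big_mkord xpredT (fun i => (i < a %/ b) : nat)).
rewrite (big_cat_nat (leq0n _) (leq_div a b)) /=.
rewrite [X in _ + X](eq_big_nat _ _ (F2 := fun=> 0)); last first.
  by move=> i /andP[ai _]; rewrite ltnNge ai.
rewrite [X in X + _](eq_big_nat _ _ (F2 := fun=> 1)); last by move=> i /andP[_ ->].
by rewrite !sum_nat_const_nat subn0 muln1 muln0 addn0.
Qed.

Lemma recursive_div n (a b : n.-tuple nat -> nat) : (forall v, 0 < b v) ->
  recursive a -> recursive b -> recursive (fun v => a v %/ b v).
Proof.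
move=> b0 aR bR.
apply: recursive_eq (recursive_sum aR
  (F := fun i v => i.+1 * b v <= a v) _) _; last first.
  by move=> v; rewrite divn_sum.
apply: recursive_leq; last exact: recursive_weaken.
apply: recursive_mul; last exact: recursive_weaken.
exact: recursive_succ (@recursive_thead _).
Qed.

Lemma recursive_mod n (a b : n.-tuple nat -> nat) : (forall v, 0 < b v) ->
  recursive a -> recursive b -> recursive (fun v => a v %% b v).
Proof.
move=> b0 aR bR; apply: recursive_eq (recursive_sub aR
  (recursive_mul (recursive_div b0 aR bR) bR)) _ => v.
by rewrite {2}(divn_eq (a v) (b v)) addKn.
Qed.

(** * Binary cells of the Cantor space *)

(* Cells of length m are indexed by B < 2 ^ m, the first bit being the least
   significant: passing to a prefix of length j is reduction modulo 2 ^ j. *)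
Definition binval (w : nat -> bool) (m : nat) : nat := \sum_(i < m) w i * 2 ^ i.

Lemma binvalS w m : binval w m.+1 = binval w m + w m * 2 ^ m.
Proof. exact: big_ord_recr. Qed.

Lemma binval_lt w m : binval w m < 2 ^ m.
Proof.
elim: m => [|m IH]; first by rewrite /binval big_ord0.
by rewrite binvalS expnS; case: (w m); lia.
Qed.

Lemma binval_mod w j m : j <= m -> binval w m %% 2 ^ j = binval w j.
Proof.
move=> /subnK <-; elim: (m - j) => [|i IH]; first exact/modn_small/binval_lt.
by rewrite addSn binvalS expnD mulnA addnC modnMDl.
Qed.

Lemma binval_agree w w' j m : j <= m -> binval w m = binval w' m ->
  binval w j = binval w' j.
Proof. by move=> jm E; rewrite -(binval_mod w jm) E binval_mod. Qed.

(** The sequence of binary digits of [B] is the witness that a cell of index below 2^m is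
    nonempty. *)
Lemma binval_odd B m : binval (fun i => odd (B %/ 2 ^ i)) m = B %% 2 ^ m.
Proof.
elim: m => [|m IH]; first by rewrite modn1 /binval big_ord0.
rewrite binvalS IH [in RHS](divn_eq B (2 ^ m)).
set q := B %/ 2 ^ m; have r_lt : B %% 2 ^ m < 2 ^ m by rewrite ltn_mod expn_gt0.
have -> : q * 2 ^ m + B %% 2 ^ m =
    q./2 * 2 ^ m.+1 + (B %% 2 ^ m + odd q * 2 ^ m).
  by rewrite -{1}[q]odd_double_half expnS -muln2; ring.
rewrite modnMDl [RHS]modn_small // expnS.
by case: (odd q); lia.
Qed.

(** Bijective base-2 numeration shifted by one is ordinary binary with a leading digit 1; the
    remaining digits are the cell index. *)
Lemma str_code_mkseq w m : (str_code (mkseq w m)).+1 = 2 ^ m + binval w m.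
Proof.
elim: m w => [|m IH] w; first by rewrite /binval big_ord0.
have -> : mkseq w m.+1 = w 0 :: mkseq (fun i => w i.+1) m.
  by rewrite /mkseq /= (iotaDl 1 0) -map_comp.
rewrite /binval big_ord_recl /= muln1.
under eq_bigr do rewrite expnS mulnCA.
rewrite -big_distrr /= -/(binval (fun i => w i.+1) m).
have := IH (fun i => w i.+1); rewrite expnS; lia.
Qed.

Lemma str_code_inj : injective str_code.
Proof.
elim=> [|b x IH] [|c y] //=; try by lia.
by move=> E; have [] : str_code x = str_code y /\ b = c;
  [move: E; case: b; case: c; lia | move=> /IH -> ->].
Qed.

Definition cell m B : set Omega := [set w | binval w m = B].

Lemma mkseq_binval (w w' : nat -> bool) m :
  mkseq w m = mkseq w' m <-> binval w m = binval w' m.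
Proof.
have E u := str_code_mkseq u m.
split=> [e|e]; first by apply/(@addnI (2 ^ m)); rewrite -!E e.
by apply/str_code_inj/succn_inj; rewrite !E e.
Qed.

Lemma cyl_mkseq (w : nat -> bool) m : cyl (mkseq w m) = cell m (binval w m).
Proof.
by apply/seteqP; split=> u; rewrite /cyl /cell /= size_mkseq => /mkseq_binval.
Qed.

Lemma cyl_cell x : cyl x = cell (size x) ((str_code x).+1 - 2 ^ size x).
Proof.
rewrite -[in cyl x](mkseq_nth false x) cyl_mkseq; congr cell.
by rewrite -[X in str_code X](mkseq_nth false x) str_code_mkseq addKn.
Qed.

Lemma str_code_range x : 2 ^ size x <= (str_code x).+1 < 2 ^ (size x).+1.
Proof.
rewrite -[X in str_code X](mkseq_nth false x) str_code_mkseq leq_addr /=.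
by rewrite expnS mul2n -addnn ltn_add2l binval_lt.
Qed.

Lemma cell_nonempty m B : B < 2 ^ m -> exists w : nat -> bool, binval w m = B.
Proof.
by move=> Bm; exists (fun i => odd (B %/ 2 ^ i)); rewrite binval_odd modn_small.
Qed.

Lemma measurable_cyl x : measurable (cyl x : set Omega).
Proof. by apply: sub_sigma_algebra; exists x. Qed.

Lemma measurable_cell m B : measurable (cell m B).
Proof.
have [Bm|Bm] := ltnP B (2 ^ m).
  by have [w <-] := cell_nonempty Bm; rewrite -cyl_mkseq; exact: measurable_cyl.
rewrite (_ : cell m B = set0); first exact: measurable0.
apply/seteqP; split=> // w E.
by have := binval_lt w m; rewrite (E : binval w m = B) ltnNge Bm.
Qed.

Definition level_set m (P : pred nat) : set Omega := [set w | P (binval w m)].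

Lemma measurable_level m (P : pred nat) : measurable (level_set m P).
Proof.
rewrite (_ : level_set m P = \bigcup_(B in [set B | P B]) cell m B).
  by apply: bigcup_measurable => B _; exact: measurable_cell.
apply/seteqP; split=> [w Pw|w [B PB E]]; first by exists (binval w m).
by rewrite /level_set /= (E : binval w m = B).
Qed.

(** * Real-valued calculus of the measure *)

Section RealMeasure.
Variables (R : realType) (mu : probability Omega R).
Local Open Scope ring_scope.
Implicit Types A B : set Omega.

Definition pr A : R := fine (mu A).

Lemma prE A : measurable A -> mu A = (pr A)%:E.
Proof. by move=> mA; rewrite /pr fineK // fin_num_measure. Qed.

Lemma pr_ge0 A : 0 <= pr A.
Proof. exact: fine_ge0. Qed.

Lemma pr_le A B : measurable A -> measurable B -> A `<=` B -> pr A <= pr B.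
Proof.
by move=> mA mB AB; rewrite -lee_fin -!prE //; apply: le_measure; rewrite ?inE.
Qed.

Lemma pr_setT : pr setT = 1.
Proof. by rewrite /pr probability_setT. Qed.

Lemma pr_set0 : pr set0 = 0.
Proof. by rewrite /pr measure0. Qed.

Lemma prU A B : measurable A -> measurable B -> A `&` B = set0 ->
  pr (A `|` B) = pr A + pr B.
Proof.
move=> mA mB AB; apply: EFin_inj; rewrite EFinD -!prE ?measureU //.
exact: measurableU.
Qed.

Lemma pr_leU A B : measurable A -> measurable B ->
  pr (A `|` B) <= pr A + pr B.
Proof.
move=> mA mB; rewrite -lee_fin EFinD -!prE //; last exact: measurableU.
exact: measureU2.
Qed.

Lemma pr_bigcup_ord n (F : nat -> set Omega) : (forall i, measurable (F i)) ->
  (forall i j, (i < n)%N -> (j < n)%N -> F i `&` F j !=set0 -> i = j) ->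
  pr (\bigcup_(i < n) F i) = \sum_(i < n) pr (F i).
Proof.
move=> mF; elim: n => [|n IH] dF.
  by rewrite bigcup_mkord big_ord0 big_ord0 pr_set0.
rewrite big_ord_recr /= -IH; last by move=> i j ni nj; apply: dF; rewrite ltnS ltnW.
rewrite !bigcup_mkord big_ord_recr /= prU //.
- by rewrite -bigcup_mkord; apply: bigcup_measurable.
rewrite -bigcup_mkord; apply/seteqP; split=> // w [[i /= ni Fi] Fn].
by have := dF i n (ltnW ni) (ltnSn n) (ex_intro _ w (conj Fi Fn)); lia.
Qed.

Lemma pr_bigcup_le n (F : nat -> set Omega) : (forall i, measurable (F i)) ->
  pr (\bigcup_(i < n) F i) <= \sum_(i < n) pr (F i).
Proof.
move=> mF; elim: n => [|n IH].
  by rewrite bigcup_mkord !big_ord0 pr_set0.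
rewrite big_ord_recr /= (le_trans _ (lerD IH (lexx _))) //.
rewrite !bigcup_mkord big_ord_recr /= pr_leU //.
by rewrite -bigcup_mkord; apply: bigcup_measurable.
Qed.

Lemma pr_cells m A : measurable A ->
  pr A = \sum_(b < 2 ^ m) pr (A `&` cell m b).
Proof.
move=> mA; rewrite -(@pr_bigcup_ord _ (fun b => A `&` cell m b)).
- congr pr; apply/seteqP; split=> [w Aw|w [b _ []]//].
  by exists (binval w m) => //=; rewrite binval_lt.
- by move=> b; apply: measurableI => //; exact: measurable_cell.
- by move=> i j _ _ [w [[_ <-] [_ <-]]].
Qed.

End RealMeasure.

(** * Approximating the measure of cells *)

Local Open Scope ring_scope.

Lemma recursive_curry3 (p : 3.-tuple nat -> nat) : recursive p ->
  recursive (fun v : 3.-tuple nat => p [tuple thead v; thead (behead_tuple v);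
    thead (behead_tuple (behead_tuple v))]).
Proof.
move=> pR; apply: recursive_eq pR _ => v; congr p.
apply: val_inj; rewrite /= /thead !(tnth_nth 0%N).
by case: v => -[|a [|b [|c []]]].
Qed.

(** Scaling by D + 1 turns the approximation error into at most 1, and rounding down costs at most 1
    more. Truncated subtraction replaces a negative approximation by 0, which is harmless since [x]
    is nonnegative. *)
Lemma floor_approx (R : realType) (p r d D : nat) (x : R) :
  0 <= x -> `|x - (p%:R - r%:R) / d.+1%:R| <= D.+1%:R^-1 ->
  D.+1%:R * x - 2 <= (((p - r) * D.+1) %/ d.+1)%:R <= D.+1%:R * x + 1.
Proof.
move=> x0.
set W := (_ %/ _)%N.
have d0 : 0 < d.+1%:R :> R by rewrite ltr0n.
have D0 : 0 < D.+1%:R :> R by rewrite ltr0n.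
set y := _ / _; rewrite ler_norml => /andP[h1 h2].
have [W1 W2] : W%:R * d.+1%:R <= (p - r)%:R * D.+1%:R :> R /\
               (p - r)%:R * D.+1%:R < (W%:R + 1) * d.+1%:R :> R.
  rewrite -!natrM natr1 -natrM ler_nat ltr_nat leq_trunc_div; split => //.
  by rewrite -ltn_divLR.
have Dy : D.+1%:R * y * d.+1%:R = (p%:R - r%:R) * D.+1%:R.
  by rewrite /y -mulrA divfK ?gt_eqF // mulrC.
have h1' : D.+1%:R * y <= D.+1%:R * x + 1.
  rewrite -(@ler_pM2l _ D.+1%:R) // in h1.
  by move: h1; rewrite mulrBr mulrN mulfV ?pnatr_eq0 //; lra.
have h2' : D.+1%:R * x <= D.+1%:R * y + 1.
  rewrite -(@ler_pM2l _ D.+1%:R) // in h2.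
  by move: h2; rewrite mulrBr mulfV ?pnatr_eq0 //; lra.
have Dx0 : 0 <= D.+1%:R * x by rewrite mulr_ge0 // ltW.
have [rp|pr] := leqP r p.
  rewrite natrB // -Dy in W1 W2.
  by move: W1 W2; rewrite ler_pM2r // ltr_pM2r // => W1 W2; apply/andP; split; lra.
have y0 : y <= 0 by rewrite /y pmulr_lle0 ?invr_gt0 // subr_le0 ler_nat ltnW.
have Dy0 : D.+1%:R * y <= 0 by rewrite pmulr_rle0.
rewrite /W (_ : (p - r)%N = 0%N) ?mul0n ?div0n; last by lia.
by apply/andP; split; lra.
Qed.

Section Cells.
Variables (R : realType) (mu : probability Omega R).
Let P := pr mu.

Lemma recursive_weights : computable_measure mu ->
  exists2 W : nat -> nat -> nat -> nat,
    recursive (fun v : 3.-tuple nat => W (thead v) (thead (behead_tuple v))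
      (thead (behead_tuple (behead_tuple v)))) &
    forall m D B, (0 < D)%N -> (B < 2 ^ m)%N ->
      D%:R * P (cell m B) - 2 <= (W m D B)%:R <= D%:R * P (cell m B) + 1.
Proof.
move=> [q [p [r [d [pR rR dR qE]]]] qmu].
(* The string coded by 2^m + B - 1 defines the cell [B]; the entries 0 and D - 1 request precision 1
   / D. *)
pose arg m D B := [tuple (2 ^ m + B).-1; 0%N; D.-1].
have argR (f : 3.-tuple nat -> nat) : recursive f ->
    recursive (fun v : 3.-tuple nat => f (arg (thead v) (thead (behead_tuple v))
      (thead (behead_tuple (behead_tuple v))))).
  move=> /recursive_curry3 fR.
  apply: (@recursive_comp3 _ (fun a b c => f [tuple a; b; c])) => //.
  - apply: recursive_pred; apply: recursive_add.
      by apply: recursive_exp2; exact: recursive_thead.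
    exact: (recursive_weaken (recursive_weaken (@recursive_thead _))).
  - exact: recursive_const.
  - by apply: recursive_pred; exact: (recursive_weaken (@recursive_thead _)).
exists (fun m D B => ((p (arg m D B) - r (arg m D B)) * D) %/ (d (arg m D B)).+1)%N.
  apply: recursive_div => //.
    apply: recursive_mul; first by apply: recursive_sub; exact: argR.
    exact: (recursive_weaken (@recursive_thead _)).
  by apply: recursive_succ; exact: argR.
move=> m [//|D] B _ Bm; apply: floor_approx; first exact: pr_ge0.
have [w wB] := cell_nonempty Bm.
have := qmu (mkseq w m) 0%N D.
rewrite cyl_mkseq wB prE; last exact: measurable_cell.
rewrite (_ : [tuple str_code _; _; _] = arg m D.+1 B); last first.
  by rewrite /arg -wB -str_code_mkseq.
rewrite qE /ratn -EFinB abse_EFin lee_fin subr0.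
by rewrite !(fmorph_div, rmorphB, rmorph_nat) mul1r.
Qed.

(* Otherwise Koenig's lemma gives a branch all of whose cells have measure at
   least e, that is, an atom. *)
Lemma small_cells (e : R) : non_atomic mu -> 0 < e ->
  exists m0, forall m B, (m0 <= m)%N -> P (cell m B) <= e.
Proof.
move=> na e0; apply: contrapT => H.
(* The infinite-subtree condition of Koenig's lemma: below the prefix of length [j], every deeper
   level has a cell heavier than [e]. *)
pose big w j := forall m, (j <= m)%N ->
  exists w' : nat -> bool, binval w' j = binval w j /\ e < P (cell m (binval w' m)).
have P_anti w j m : (j <= m)%N ->
    P (cell m (binval w m)) <= P (cell j (binval w j)).
  move=> jm; apply: pr_le; try exact: measurable_cell.
  by move=> u; apply: binval_agree.
have big0 w : big w 0%N.
  move=> m _; apply: contrapT => H'; apply: H; exists m => m' B mm'.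
  have [Bm|Bm] := ltnP B (2 ^ m'); last first.
    rewrite /P (_ : cell m' B = set0) ?pr_set0 ?ltW //.
    apply/seteqP; split=> // u E.
    by have := binval_lt u m'; rewrite (E : binval u m' = B) ltnNge Bm.
  have [w' <-] := cell_nonempty Bm.
  rewrite leNgt; apply/negP => lt_e; apply: H'; exists w'; split.
    by rewrite /binval !big_ord0.
  exact: lt_le_trans lt_e (P_anti _ _ _ mm').
have bigS w j : big w j -> exists2 w' : nat -> bool,
    binval w' j = binval w j & big w' j.+1.
  move=> bw; apply: contrapT => H'.
  pose ext b i := if i == j then b else w i.
  have extE b : binval (ext b) j = binval w j.
    apply: eq_bigr => i _; rewrite /ext; case: eqP => // ij.
    by have := ltn_ord i; rewrite ij ltnn.
  have nbig b : exists2 m, (j.+1 <= m)%N & forall w' : nat -> bool,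
      binval w' j.+1 = binval (ext b) j.+1 -> P (cell m (binval w' m)) <= e.
    have /existsNP[m] : ~ big (ext b) j.+1.
      by move=> bb; apply: H'; exists (ext b).
    move=> /not_implyP[jm /forallNP nw]; exists m => // w' ww'.
    by rewrite leNgt; apply/negP => lt_e; apply: (nw w').
  have [m1 jm1 h1] := nbig true; have [m2 jm2 h2] := nbig false.
  (* If neither child were big, a heavy cell deeper than both failure levels would lie below one of
     them; shrinking cells lose measure, a contradiction. *)
  have [w' [ww' lt_e]] := bw (maxn m1 m2) ltac:(lia).
  have : binval w' j.+1 = binval (ext (w' j)) j.+1.
    by rewrite !binvalS extE ww' /ext eqxx.
  case: (w' j) => [/h1|/h2] le_e; move: lt_e; rewrite ltNge => /negP; apply;
    apply: le_trans le_e; apply: P_anti; lia.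
have [f fP] : exists f : nat -> nat -> bool, forall j,
    big (f j) j /\ binval (f j.+1) j = binval (f j) j.
  pose T := {p : nat * (nat -> bool) | big p.2 p.1}.
  have step (p : T) : {p' : T | (sval p').1 = (sval p).1.+1 &
      binval (sval p').2 (sval p).1 = binval (sval p).2 (sval p).1}.
    apply: cid2; case: p => -[j w] /= bw; have [w' ww' bw'] := bigS _ _ bw.
    by exists (exist _ (j.+1, w') bw').
  pose F := fix F n : T := if n is n'.+1 then s2val (step (F n'))
    else exist _ (0%N, fun=> false) (big0 (fun=> false)).
  have F1 n : (sval (F n)).1 = n.
    by elim: n => //= n IH; rewrite (s2valP (step (F n))) IH.
  exists (fun n => (sval (F n)).2) => n; split.
    by have := svalP (F n); rewrite F1.
  have E : binval (sval (F n.+1)).2 (sval (F n)).1 =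
    binval (sval (F n)).2 (sval (F n)).1 := s2valP' (step (F n)).
  by rewrite F1 in E.
(* Bit [i] no longer changes from stage i + 1 on, so the diagonal is the limit branch. *)
pose w i := f i.+1 i.
have fw j : binval (f j) j = binval w j.
  elim: j => [|j IH]; first by rewrite /binval !big_ord0.
  by rewrite [RHS]binvalS [LHS]binvalS (fP j).2 IH.
have we j : e <= P (cell j (binval w j)).
  have [w' [ww' lt_e]] := (fP j).1 j (leqnn j).
  by rewrite -fw -ww' ltW.
have : mu (\bigcap_j cell j (binval w j)) = 0%E.
  rewrite (_ : \bigcap_j _ = [set w]); first exact: na.
  apply/seteqP; split=> [u uw|_ -> //]; apply/funext => i.
  have : binval u i.+1 = binval w i.+1 by exact: (uw i.+1).
  rewrite !binvalS (uw i _ : binval u i = binval w i) // => /addnI/eqP.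
  by rewrite eqn_pmul2r ?expn_gt0 // => /eqP; case: (u i); case: (w i).
have cvg : mu (cell j (binval w j)) @[j --> \oo] -->
    mu (\bigcap_j cell j (binval w j)).
  apply: nonincreasing_cvg_mu.
  - by rewrite -ge0_fin_numE // fin_num_measure //; exact: measurable_cell.
  - by move=> i; exact: measurable_cell.
  - by apply: bigcapT_measurable => i; exact: measurable_cell.
  - by apply/nonincreasing_seqP => n; apply/subsetPset => u; apply: binval_agree.
move=> mu0; have : (e%:E <= mu (\bigcap_j cell j (binval w j)))%E.
  rewrite -(cvg_lim _ cvg) //; apply: lime_ge.
    by apply/cvg_ex; eexists; exact: cvg.
  by apply: nearW => j; rewrite prE ?lee_fin; [exact: we | exact: measurable_cell].
by rewrite mu0 lee_fin leNgt e0.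
Qed.

End Cells.

(** * Sparse sets nearly independent of the past *)

Local Open Scope nat_scope.

Ltac recursive_var := first
  [ exact: recursive_thead
  | exact: (recursive_weaken (@recursive_thead _))
  | exact: (recursive_weaken (recursive_weaken (@recursive_thead _)))
  | exact: (recursive_weaken (recursive_weaken
      (recursive_weaken (@recursive_thead _))))
  | exact: (recursive_weaken (recursive_weaken
      (recursive_weaken (recursive_weaken (@recursive_thead _)))))
  | exact: (recursive_weaken (recursive_weaken (recursive_weaken
      (recursive_weaken (recursive_weaken (@recursive_thead _))))))].

Ltac recursive_arith := repeat match goal with
  | |- forall _, _ => by move=> ?; rewrite expn_gt0
  | |- recursive (fun _ => addn _ _) => apply: recursive_add
  | |- recursive (fun _ => subn _ _) => apply: recursive_sub
  | |- recursive (fun _ => muln _ _) => apply: recursive_mul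
  | |- recursive (fun _ => expn 2 _) => apply: recursive_exp2
  | |- recursive (fun _ => modn _ _) => apply: recursive_mod
  | |- recursive (fun _ => S _) => apply: recursive_succ
  | |- recursive (fun _ => nat_of_bool (leq _ _)) => apply: recursive_leq
  | |- recursive (fun _ => nat_of_bool (andb _ _)) => apply: recursive_and
  | |- recursive (fun _ => nat_of_bool (orb _ _)) => apply: recursive_or
  | |- recursive (fun _ => nat_of_bool (eq_op _ _)) => apply: recursive_eqn
  | |- recursive (fun _ => ?c) => exact: recursive_const
  | |- _ => recursive_var
  end.

(** Prefix sums increase, so the indices taken form an initial segment. It ends once its weight
    reaches T / c, and the overshoot is at most the one item that crossed this threshold. *)
Lemma greedy_sum (w : nat -> nat) (M c d : nat) (T := \sum_(i < M) w i)
    (S := \sum_(i < M) (c * (\sum_(j < i) w j) < T) * w i) :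
  0 < c -> (forall i, i < M -> w i <= d) -> T <= c * S <= T + c * d.
Proof.
move=> c0 wd.
pose s N := \sum_(i < N) (c * (\sum_(j < i) w j) < T) * w i.
pose p N := \sum_(i < N) w i.
(* Invariant: either nothing has been rejected so far or the threshold has been reached. *)
have : [/\ s M <= p M, c * s M <= T + c * d & s M = p M \/ T <= c * s M].
  elim: {-2}M (leqnn M) => [|N IH] NM.
    by rewrite /s /p !big_ord0 muln0; split=> //; left.
  have [sp sT sE] := IH (ltnW NM); have wN := wd N NM.
  rewrite /s /p !big_ord_recr /= -/(s N) -/(p N).
  case: ltnP => cp; rewrite ?mul1n ?mul0n ?addn0.
    have sE' : s N = p N.
      by case: sE => // Ts; move: (leq_mul (leqnn c) sp); lia.
    by split; [lia | nia | left; lia].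
  split=> //; first by lia.
  by case: sE => [->|]; right.
have -> : S = s M by [].
by move=> [_ -> [->|->]] //; rewrite andbT leq_pmull.
Qed.

Section Selection.
Variable W : nat -> nat -> nat -> nat.
Hypothesis W_recursive :
  recursive (fun v : 3.-tuple nat => W (thead v) (thead (behead_tuple v))
    (thead (behead_tuple (behead_tuple v)))).

(** At this scale an error of 8 * 2^m integer units, a few units for each of the 2^m cells, is
    exactly the tolerance 2^-(2n+3) in measure. *)
Definition weight n m B := W m (2 ^ (m + 2 * n + 6)) B.

Lemma recursive_weight :
  recursive (fun v : 3.-tuple nat => weight (thead v) (thead (behead_tuple v))
    (thead (behead_tuple (behead_tuple v)))).
Proof. by apply: (recursive_comp3 W_recursive); recursive_arith. Qed.

(** The bound 2^(m+2) on weights corresponds to measure about 2^-(2n+4), so one greedy overshoot is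
    negligible. Being a condition on integers it is decidable, and a fine level can be searched
    for. *)
Definition fine_level n m :=
  (n < m) && ([exists B : 'I_(2 ^ m), 2 ^ (m + 2) < weight n m B] == 0 :> nat).

Lemma recursive_fine_level :
  recursive (fun v : 2.-tuple nat =>
    fine_level (thead v) (thead (behead_tuple v)) : nat).
Proof.
rewrite /fine_level; apply: recursive_and; first by recursive_arith.
apply: recursive_eqn; last exact: recursive_const.
apply: (@recursive_exists 2 (fun v => 2 ^ thead (behead_tuple v))
  (fun B v => 2 ^ (thead (behead_tuple v) + 2)
    < weight (thead v) (thead (behead_tuple v)) B)); first by recursive_arith.
by apply: recursive_leq; recursive_arith;
  apply: (recursive_comp3 recursive_weight); recursive_arith.
Qed.

Definition class_weight n m c N :=
  \sum_(B < N) (B %% 2 ^ n == c) * weight n m B.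

Lemma recursive_class_weight (k : nat) (n m c N : k.-tuple nat -> nat) :
  recursive n -> recursive m -> recursive c -> recursive N ->
  recursive (fun v => class_weight (n v) (m v) (c v) (N v)).
Proof.
move=> nR mR cR NR.
apply: (@recursive_sum _ _
  (fun B v => (B %% 2 ^ n v == c v) * weight (n v) (m v) B)) => //.
have nR' := recursive_weaken nR; have mR' := recursive_weaken mR.
have cR' := recursive_weaken cR.
apply: recursive_mul.
  apply: recursive_eqn => //; apply: recursive_mod => [v||]; rewrite ?expn_gt0 //.
    exact: recursive_thead.
  exact: recursive_exp2.
by apply: (recursive_comp3 recursive_weight) => //; exact: recursive_thead.
Qed.

(* Among the extensions to length m of its prefix of length n, the cell B is
   selected if those before it weigh less than 2 ^- k of the total. *)
Definition selected n m k B :=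
  2 ^ k * class_weight n m (B %% 2 ^ n) B
    < class_weight n m (B %% 2 ^ n) (2 ^ m).

Lemma selected_weight n m k c : fine_level n m -> 
  let S := \sum_(B < 2 ^ m) (B %% 2 ^ n == c) * (selected n m k B * weight n m B) in
  class_weight n m c (2 ^ m) <= 2 ^ k * S
    <= class_weight n m c (2 ^ m) + 2 ^ k * 2 ^ (m + 2).
Proof.
move=> /andP[_]; rewrite eqb0 => /existsPn fineW.
(* Cells outside the class get weight 0, so sums over the class become plain sums and the greedy
   lemma applies. *)
pose w B := (B %% 2 ^ n == c) * weight n m B.
have wd i : i < 2 ^ m -> w i <= 2 ^ (m + 2).
  move=> im; rewrite /w; case: eqP => // _; rewrite mul1n.
  by have := fineW (Ordinal im); rewrite -leqNgt.
have k0 : 0 < 2 ^ k by rewrite expn_gt0.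
rewrite /=; have -> : \sum_(B < 2 ^ m)
    (B %% 2 ^ n == c) * (selected n m k B * weight n m B) =
    \sum_(i < 2 ^ m) (2 ^ k * (\sum_(j < i) w j) < \sum_(i < 2 ^ m) w i) * w i.
  apply: eq_bigr => i _; rewrite mulnCA /selected -/(w i).
  by rewrite /w; case: eqP => [->|_]; rewrite ?mul0n ?muln0.
exact: greedy_sum k0 wd.
Qed.

End Selection.

Local Open Scope ring_scope.

(** Three errors add up: 2M from rounding the selected part, 4M from the greedy overshoot, and at
    most 2M from rounding the whole class, after division by [d]. *)
Lemma selection_error (R : realFieldType) (D M d x y S T : R) :
  1 <= d -> 0 <= M -> T <= d * S -> d * S <= T + d * (2 * (2 * M)) ->
  `| D * x - S | <= 2 * M -> `| D * y - T | <= 2 * M ->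
  `| D * (x - d^-1 * y) | <= 8 * M.
Proof.
move=> d1 M0 TS ST hS hT; have d0 : 0 < d by lra.
have e : D * (d^-1 * y) * d = D * y by field; rewrite gt_eqF.
have Md : M <= M * d by rewrite ler_peMr.
move: hS hT; rewrite mulrBr !ler_norml => /andP[s1 s2] /andP[t1 t2].
rewrite -(ler_pM2r d0) in s1; rewrite -(ler_pM2r d0) in s2.
by apply/andP; split; rewrite -(ler_pM2r d0) mulrBl e; lra.
Qed.

Section SparseSets.
Variables (R : realType) (mu : probability Omega R).
Local Notation P := (pr mu).

Lemma pr_select n m (s : pred nat) c : (n <= m)%N ->
  P (level_set m s `&` cell n c) =
  \sum_(B < 2 ^ m) ((B %% 2 ^ n)%N == c)%:R * ((s B)%:R * P (cell m B)).
Proof.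
move=> nm; have mU : measurable (level_set m s `&` cell n c).
  by apply: measurableI; [exact: measurable_level | exact: measurable_cell].
rewrite (pr_cells mu m mU); apply: eq_bigr => B _.
case: eqP => [Bc|Bc]; last first.
  rewrite mul0r (_ : _ `&` _ = set0) ?pr_set0 //.
  apply/seteqP; split=> // w [[_ wc] wB]; apply: Bc.
  by rewrite -(wB : binval w m = B) binval_mod // -(wc : binval w n = c).
rewrite mul1r; case: (boolP (s B)) => sB; last first.
  rewrite mul0r (_ : _ `&` _ = set0) ?pr_set0 //.
  apply/seteqP; split=> // w [[/= sw _] wB].
  by move: sB; rewrite -(wB : binval w m = B) (sw : s (binval w m)).
rewrite mul1r; congr pr; apply/seteqP; split=> [w []//|w wB].
have wB' : binval w m = B by [].
by split=> //; split; rewrite /level_set /cell /= ?wB' // -(binval_mod w nm) wB'.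
Qed.

Lemma sum_approx (M : nat) (D : R) (p : nat -> R) (w : nat -> nat)
    (s : nat -> bool) :
  (forall B, (B < M)%N -> D * p B - 2 <= (w B)%:R <= D * p B + 1) ->
  `| D * (\sum_(B < M) (s B)%:R * p B) - (\sum_(B < M) s B * w B)%:R | <= 2 * M%:R.
Proof.
move=> pw; rewrite mulr_sumr natr_sum -sumrB.
apply: le_trans (ler_norm_sum _ _ _) _.
rewrite -[M in 2 * M%:R]card_ord mulr_natr -sumr_const; apply: ler_sum => B _.
have /andP[h1 h2] := pw B (ltn_ord B); rewrite natrM.
by case: (s B); rewrite ?mul1r ?mul0r ?mulr0 ?subr0 ?normr0 // ler_norml;
  apply/andP; split; lra.
Qed.

(** Non-atomicity makes the search for each next level succeed, and greedy selection inside every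
    cell of length [lev k] gives [U_k] the same density there, up to the rounding error. *)
Lemma sparse_sets : computable_measure mu -> non_atomic mu ->
  exists (lev : nat -> nat) (sel : nat -> nat -> bool),
  [/\ recursive (fun v : 1.-tuple nat => lev (thead v)),
      recursive (fun v : 2.-tuple nat =>
        sel (thead v) (thead (behead_tuple v)) : nat),
      forall k, (lev k < lev k.+1)%N &
      forall k c, `| P (level_set (lev k.+1) (sel k) `&` cell (lev k) c)
        - 2 ^- k * P (cell (lev k) c) | <= 2 ^- (2 * lev k + 3)].
Proof.
move=> mu_comp na; have [W WR WE] := recursive_weights mu_comp.
have exF n : exists m, fine_level W n m.
  (* Scaled by 2^(m+2n+6) this is 2^(m+1), which leaves room for the rounding error 1 below
     2^(m+2). *)
  have e0 : 0 < 2 ^- (2 * n + 5) :> R by rewrite invr_gt0 exprn_gt0.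
  have [m0 hm0] := small_cells na e0; exists (maxn n.+1 m0).
  rewrite /fine_level leq_max leqnn /= eqb0; apply/existsPn => B.
  set m := maxn _ _ in B *; rewrite -leqNgt -(ler_nat R).
  have D0 : (0 < 2 ^ (m + 2 * n + 6))%N by rewrite expn_gt0.
  have /andP[_ h] := WE m _ B D0 (ltn_ord B); apply: le_trans h _.
  have /= h := hm0 m B (leq_maxr _ _).
  have : (2 ^ (m + 2 * n + 6))%:R * P (cell m B) <= 2 ^+ m.+1.
    apply: (le_trans (ler_wpM2l (ler0n _ _) h)).
    by rewrite natrX ler_pdivrMr ?exprn_gt0 // -exprD; apply: ler_weXn2l;
      [lra | lia].
  have : 1 <= 2 ^+ m.+1 :> R by apply: exprn_ege1; lra.
  have -> : (2 ^ (m + 2))%:R = 2 * 2 ^+ m.+1 :> R by rewrite natrX addn2 exprS.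
  lra.
pose next n := ex_minn (exF n).
have nextR : recursive (fun v : 1.-tuple nat => next (thead v)).
  (* This function vanishes exactly at the fine levels, as [rec_min] demands. *)
  pose f (v : 2.-tuple nat) :=
    (1 - fine_level W (thead (behead_tuple v)) (thead v))%N.
  apply: (@rec_min 1 f).
  - apply: recursive_sub; first exact: recursive_const.
    apply: (@recursive_comp2 _ (fun n m => fine_level W n m)).
    + exact: recursive_fine_level.
    + by recursive_arith.
    + by recursive_arith.
  - by move=> v; rewrite /f !thead_cons behead_cons /next; case: ex_minnP => m ->.
  - move=> v k; rewrite /f !thead_cons behead_cons /next; case: ex_minnP => m _ mn.
    by case: (boolP (fine_level _ _ k)) => // /mn; rewrite leqNgt => /negP.
have nextP n : fine_level W n (next n) by rewrite /next; case: ex_minnP.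
pose lev := nat_rect (fun=> nat) 0%N (fun _ n => next n).
have levR : recursive (fun v : 1.-tuple nat => lev (thead v)).
  apply: (@recursive_nat_rect 1 (fun=> 0%N) (@thead _ _) (fun _ n _ => next n)).
  - exact: recursive_const.
  - exact: recursive_thead.
  - by apply: (recursive_comp1 nextR); recursive_arith.
exists lev, (fun k B => selected W (lev k) (lev k.+1) k B); split => //.
- have l0 : recursive (fun v : 2.-tuple nat => lev (thead v)).
    by apply: (recursive_comp1 levR); recursive_arith.
  have l1 : recursive (fun v : 2.-tuple nat => lev (thead v).+1).
    by apply: (recursive_comp1 levR); recursive_arith.
  have cR : recursive (fun v : 2.-tuple nat =>
      (thead (behead_tuple v) %% 2 ^ lev (thead v))%N).
    apply: recursive_mod => [v||]; rewrite ?expn_gt0 //; first by recursive_arith.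
    exact: recursive_exp2.
  rewrite /selected; apply: recursive_leq; last first.
    by apply: recursive_class_weight => //; exact: recursive_exp2.
  apply: recursive_succ; apply: recursive_mul; first by recursive_arith.
  by apply: recursive_class_weight => //; recursive_arith.
- by move=> k; have /andP[] := nextP (lev k).
move=> k c; set n := lev k; set m := lev k.+1.
have fnm : fine_level W n m by exact: nextP.
have nm : (n <= m)%N by have /andP[/ltnW] := fnm.
set U := level_set _ _; pose D : R := 2 ^+ (m + 2 * n + 6).
have D0 : 0 < D by rewrite exprn_gt0.
have wE B : (B < 2 ^ m)%N ->
    D * P (cell m B) - 2 <= (weight W n m B)%:R <= D * P (cell m B) + 1.
  by move=> Bm; rewrite /D -natrX; apply: WE => //; rewrite expn_gt0.
have := selected_weight k c fnm; set S := \sum_(B < _) _; set T := class_weight _ _ _ _ _.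
move=> /= /andP[]; rewrite -!(ler_nat R) natrD !natrM !natrX => TS ST.
have hS : `| D * P (U `&` cell n c) - S%:R | <= 2 * 2 ^+ m.
  rewrite pr_select //.
  have := sum_approx (fun B => ((B %% 2 ^ n)%N == c) && selected W n m k B) wE.
  rewrite natrX; congr (`|_ * _ - _%:R| <= _); apply: eq_bigr => B _;
    by rewrite -mulnb ?natrM ?mulrA ?mulnA.
have hT : `| D * P (cell n c) - T%:R | <= 2 * 2 ^+ m.
  have := pr_select xpredT c nm.
  rewrite (_ : level_set m xpredT `&` _ = cell n c) => [->|]; last first.
    by apply/seteqP; split=> [w []|].
  have := sum_approx (fun B => (B %% 2 ^ n)%N == c) wE.
  rewrite natrX; congr (`|_ * _ - _%:R| <= _); apply: eq_bigr => B _.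
  by rewrite mul1r.
set x := P _ in hS *; set y := P _ in hT *.
rewrite -(ler_pM2l D0) -[D in D * `| _ |](ger0_norm (ltW D0)) -normrM.
have -> : D * 2 ^- (2 * n + 3) = 8 * 2 ^+ m.
  apply: (mulIf (x := 2 ^+ (2 * n + 3))); rewrite ?expf_neq0 ?pnatr_eq0 //.
  rewrite mulfVK ?expf_neq0 ?pnatr_eq0 // /D.
  have -> : 8 = 2 ^+ 3 :> R by rewrite -natrX.
  by rewrite -!exprD; congr (_ ^+ _); lia.
set d : R := 2 ^+ k in TS ST *.
have d1 : 1 <= d by rewrite exprn_ege1 // ler1n.
rewrite addn2 !exprS in ST.
by apply: (selection_error d1 _ TS ST hS hT); rewrite exprn_ge0.
Qed.

End SparseSets.

(** * The test associated with sparse sets *)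

Local Open Scope ring_scope.

Section SparseTest.
Variables (R : realType) (mu : probability Omega R).
Variables (lev : nat -> nat) (sel : nat -> nat -> bool).
Hypothesis lev_recursive : recursive (fun v : 1.-tuple nat => lev (thead v)).
Hypothesis sel_recursive : recursive (fun v : 2.-tuple nat =>
  sel (thead v) (thead (behead_tuple v)) : nat).
Hypothesis lev_lt : forall k, (lev k < lev k.+1)%N.
Local Notation P := (pr mu).
Local Notation U k := (level_set (lev k.+1) (sel k)).
Hypothesis sel_spread : forall k c,
  `| P (U k `&` cell (lev k) c) - 2 ^- k * P (cell (lev k) c) |
    <= 2 ^- (2 * lev k + 3).

Lemma leq_lev k : (k <= lev k)%N.
Proof. by elim: k => // k IH; exact: leq_ltn_trans IH (lev_lt k). Qed.

(** The additive errors over the 2^(lev k) cells sum to 2^-(lev k + 3), which is below 2^-k because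
    [k <= lev k]. *)
Lemma sparse_small k : P (U k) <= 2 * 2 ^- k.
Proof.
rewrite (pr_cells mu (lev k) (measurable_level _ _)).
set n := lev k.
apply: (@le_trans _ _ (\sum_(c < 2 ^ n) (2 ^- k * P (cell n c) + 2 ^- (2 * n + 3)))).
  apply: ler_sum => c _; have := sel_spread k c.
  by rewrite -/n ler_distl => /andP[].
rewrite big_split /= -mulr_sumr.
have -> : \sum_(c < 2 ^ n) P (cell n c) = 1.
  rewrite -(pr_setT mu) (pr_cells mu n measurableT).
  by apply: eq_bigr => c _; rewrite setTI.
rewrite sumr_const card_ord mulr1 -[X in _ + X]mulr_natl natrX.
suff : 2 ^+ n * 2 ^- (2 * n + 3) <= 2 ^- k :> R by lra.
rewrite ler_pdivrMr ?exprn_gt0 // mulrC ler_pdivlMr ?exprn_gt0 // -exprD ler_weXn2l ?ler1n //.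
by have := leq_lev k; rewrite -/n; lia.
Qed.

(** The element 0 gives sequences in no [U k] the value 0. The divisor 4 pays for the union bound,
    since the measures 2 * 2^-k for k >= k0 sum to 4 * 2^-k0. *)
Definition sparse_test (w : Omega) : \bar R :=
  ereal_sup (0%E |` [set (2 ^+ k / 4)%:E | k in [set k | U k w]]).

Lemma sparse_test_ge k w : U k w -> ((2 ^+ k / 4)%:E <= sparse_test w)%E.
Proof. by move=> Uw; apply: ereal_sup_ubound; right; exists k. Qed.

Lemma sparse_test_ge0 w : (0 <= sparse_test w)%E.
Proof. by apply: ereal_sup_ubound; left. Qed.

Lemma sparse_test_gtP (r : R) w : (r%:E < sparse_test w)%E <->
  (r < 0 \/ exists2 k, U k w & r < 2 ^+ k / 4).
Proof.
split=> [/ereal_sup_gt[_ [->|[k Uw <-]]]|[r0|[k Uw rk]]].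
- by rewrite lte_fin; left.
- by rewrite lte_fin; right; exists k.
- by apply: lt_le_trans (sparse_test_ge0 w); rewrite lte_fin.
- by apply: lt_le_trans (sparse_test_ge Uw); rewrite lte_fin.
Qed.

(** Step [n] examines the string of code [n]: the first two inequalities fix its length as
    [lev k.+1], the subtraction recovers its cell index, and the last inequality is (p - q) / (d +
    1) < 2^k / 4 without denominators. Searching k <= n loses nothing, since k < 2^(lev k.+1) <= n +
    1. A negative rational has every string listed. *)
Definition listed p q d n : bool :=
  (p < q)%N || [exists k : 'I_n.+1,
    [&& 2 ^ lev k.+1 <= n.+1, n.+1 < 2 ^ (lev k.+1).+1,
        sel k (n.+1 - 2 ^ lev k.+1) &
        4 * p < 2 ^ k * d.+1 + 4 * q]]%N.

Lemma recursive_listed : recursive (fun v : 4.-tuple nat =>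
  listed (thead v) (thead (behead_tuple v))
    (thead (behead_tuple (behead_tuple v)))
    (thead (behead_tuple (behead_tuple (behead_tuple v)))) : nat).
Proof.
apply: recursive_or; first by recursive_arith.
pose n (v : 4.-tuple nat) := thead (behead_tuple (behead_tuple (behead_tuple v))).
apply: (@recursive_exists 4 (fun v => (n v).+1)
  (fun k v => [&& 2 ^ lev k.+1 <= (n v).+1, (n v).+1 < 2 ^ (lev k.+1).+1,
    sel k ((n v).+1 - 2 ^ lev k.+1) &
    4 * thead v < 2 ^ k * (thead (behead_tuple (behead_tuple v))).+1
      + 4 * thead (behead_tuple v)]%N)); rewrite /n.
  by recursive_arith.
have levR : recursive (fun u : 5.-tuple nat => lev (thead u).+1).
  by apply: (recursive_comp1 lev_recursive); recursive_arith.
apply: recursive_and.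
  by apply: recursive_leq; [exact: recursive_exp2 | recursive_arith].
apply: recursive_and.
  apply: recursive_leq; first by recursive_arith.
  by apply: recursive_exp2; exact: recursive_succ.
apply: recursive_and; last by recursive_arith.
apply: (@recursive_comp2 _ (fun k B => sel k B : nat)) => //.
  by recursive_arith.
by apply: recursive_sub; [recursive_arith | exact: recursive_exp2].
Qed.

Lemma ratr_ratn (p q d : nat) :
  ratr (ratn p q d) = (p%:R - q%:R) / d.+1%:R :> R.
Proof. by rewrite fmorph_div rmorphB /= !ratr_nat. Qed.

Lemma lsc_sparse_test : lsc_fun sparse_test.
Proof.
pose e (v : 4.-tuple nat) := (listed (thead v) (thead (behead_tuple v))
    (thead (behead_tuple (behead_tuple v)))
    (thead (behead_tuple (behead_tuple (behead_tuple v)))) *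
    (thead (behead_tuple (behead_tuple (behead_tuple v)))).+1)%N.
exists e.
  by apply: recursive_mul; [exact: recursive_listed | recursive_arith].
move=> p q d; rewrite ratr_ratn; set r : R := _ / _.
have eE n : e [tuple p; q; d; n] = (listed p q d n * n.+1)%N by [].
have d0 : 0 < d.+1%:R :> R by rewrite ltr0n.
have r_lt k : (r < 2 ^+ k / 4) = (4 * p < 2 ^ k * d.+1 + 4 * q)%N.
  rewrite /r ltr_pdivrMr // mulrAC ltr_pdivlMr // -(ltr_nat R).
  by rewrite natrD !natrM natrX -ltrBlDr; congr (_ < _); ring.
have r_lt0 : (r < 0) = (p < q)%N.
  by rewrite /r pmulr_llt0 ?invr_gt0 // subr_lt0 ltr_nat.
apply/seteqP; split=> [w /= /sparse_test_gtP[r0|[k Uw rk]]|w [x [n]]].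
(* The empty string has code 0 and its interval is the whole space. *)
- exists (mkseq w 0); last by rewrite cyl_mkseq.
  by exists 0%N; rewrite eE /listed -r_lt0 r0.
- set m := lev k.+1 in Uw; exists (mkseq w m); last by rewrite cyl_mkseq.
  exists (str_code (mkseq w m)); rewrite eE /listed.
  suff -> : [exists k : 'I_(str_code (mkseq w m)).+1,
    [&& 2 ^ lev k.+1 <= (str_code (mkseq w m)).+1,
        (str_code (mkseq w m)).+1 < 2 ^ (lev k.+1).+1,
        sel k ((str_code (mkseq w m)).+1 - 2 ^ lev k.+1) &
        4 * p < 2 ^ k * d.+1 + 4 * q]]%N by rewrite orbT mul1n.
  have kS : (k < (str_code (mkseq w m)).+1)%N.
    rewrite str_code_mkseq; apply: (@leq_trans (2 ^ m)); last exact: leq_addr.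
    by apply: leq_trans (leq_lev k.+1) _; rewrite ltnW // ltn_expl.
  apply/existsP; exists (Ordinal kS) => /=; rewrite -r_lt rk str_code_mkseq.
  rewrite leq_addr addKn (Uw : sel k _) expnS mul2n -addnn ltn_add2l.
  by rewrite binval_lt.
rewrite eE; case: (boolP (listed p q d n)); last by rewrite mul0n.
rewrite mul1n => + [nx] xw; rewrite {}nx => /orP[|/existsP[k /and4P[x1 x2 selx rk]]].
  by rewrite -r_lt0 => r0; apply/sparse_test_gtP; left.
apply/sparse_test_gtP; right; exists k; last by rewrite r_lt.
have /andP[y1 y2] := str_code_range x.
have sx : size x = lev k.+1.
  have h1 : (size x < (lev k.+1).+1)%N.
    by rewrite -(@ltn_exp2l 2) // (leq_ltn_trans y1 x2).
  have h2 : (lev k.+1 < (size x).+1)%N.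
    by rewrite -(@ltn_exp2l 2) // (leq_ltn_trans x1 y2).
  by apply/eqP; rewrite eqn_leq; apply/andP.
move: xw; rewrite cyl_cell sx /cell /= => wx.
by rewrite /level_set /= wx.
Qed.

(** With k0 the least index whose value exceeds [c], the union bound over k >= k0 gives 4 * 2^-k0,
    which is below 1 / c. *)
Lemma probability_bounded_sparse_test : probability_bounded mu sparse_test.
Proof.
move=> c0 c0_gt0; rewrite -[ratr c0^-1]/(ratr (c0^-1)) fmorphV.
set c : R := ratr c0; have c_gt0 : 0 < c by rewrite ltr0q.
have exk : exists k, c < 2 ^+ k / 4.
  have [k hk] : exists k : nat, 4 * c < k%:R.
    by exists (Num.bound (4 * c)); apply: archi_boundP; lra.
  exists k; rewrite ltr_pdivlMr // mulrC (lt_trans hk) // -natrX ltr_nat.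
  by rewrite ltn_expl.
pose k0 := ex_minn exk.
have [ck0 k0_min] : c < 2 ^+ k0 / 4 /\ forall k, c < 2 ^+ k / 4 -> (k0 <= k)%N.
  by rewrite /k0; case: ex_minnP.
have -> : [set w | (c%:E < sparse_test w)%E] = 
    \bigcup_(k in [set k | c < 2 ^+ k / 4]) U k.
  apply/seteqP; split=> [w /sparse_test_gtP[|[k Uw ck]]|w [k ck Uw]].
  - by rewrite ltNge ltW.
  - by exists k.
  - by apply/sparse_test_gtP; right; exists k.
have e0 : 0 <= 4 * 2 ^- k0 :> R by rewrite mulr_ge0 // invr_ge0 exprn_ge0.
apply: (@le_trans _ _ (4 * 2 ^- k0)%:E); last first.
  rewrite lee_fin -(@ler_pM2r _ c) // mulVf ?gt_eqF // mulrC mulrA.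
  rewrite ler_pdivrMr ?exprn_gt0 // mul1r; lra.
(* The bound is spread as a geometric series, whose term of index k is 2 * 2^-(k0 + k). *)
apply: le_trans (epsilon_trick0 xpredT e0).
apply: (@le_trans _ _ (\sum_(k <oo) mu (U (k0 + k)))%E); last first.
  apply: lee_nneseries => // k _; rewrite prE; last exact: measurable_level.
  rewrite lee_fin; apply: le_trans (sparse_small _) _.
  rewrite natrX exprD exprS !invfM mulrACA.
  by rewrite (_ : 4 * 2^-1 = 2) ?mulrA //; lra.
apply: measure_sigma_subadditive.
- by move=> k; exact: measurable_level.
- by apply: bigcup_measurable => k _; exact: measurable_level.
- move=> w [k ck Uw]; exists (k - k0)%N => //.
  by rewrite subnKC // k0_min.
Qed.

Lemma pb_sparse_test : pb_test mu sparse_test.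
Proof.
split; [exact: sparse_test_ge0 | exact: lsc_sparse_test |].
exact: probability_bounded_sparse_test.
Qed.

End SparseTest.

(** * First hits of the sparse sets *)

(** The harmonic series diverges; at the least [L] that crosses [M], the last term overshoots by at
    most [kappa]. *)
Lemma harmonic_tail_sum (R : realType) (kappa M : R) (k0 : nat) :
  0 < kappa -> 0 <= M -> (0 < k0)%N ->
  exists L : nat, M < \sum_(i < L) kappa / (k0 + i)%:R <= M + kappa.
Proof.
move=> kappa0 M0 k00.
have k00' : 0 < k0%:R :> R by rewrite ltr0n.
have exL : exists L : nat, M < \sum_(i < L) kappa / (k0 + i)%:R.
  apply: contrapT => /forallNP H; apply: (@dvg_harmonic R).
  apply: nondecreasing_is_cvgn.
    by apply/nondecreasing_seqP => n; rewrite seriesSr lerDl harmonic_ge0.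
  (* Since k0 + i <= k0 (i + 1), bounded tail sums would bound the harmonic series. *)
  exists (M * k0%:R / kappa) => _ [n _ <-].
  rewrite ler_pdivlMr // -ler_pdivrMr // -mulrA.
  apply: le_trans (_ : \sum_(i < n) kappa / (k0 + i)%:R <= _); last first.
    by have /negP := H n; rewrite -leNgt.
  rewrite /series /= big_mkord mulr_suml; apply: ler_sum => i _.
  rewrite mulrCA ler_pM2l // -invfM -natrM lef_pV2 ?posrE ?ltr0n; try lia.
  by rewrite ler_nat; nia.
exists (ex_minn exL); case: ex_minnP => -[|L]; first by rewrite big_ord0 ltNge M0.
move=> h hmin; rewrite h /= big_ord_recr /= lerD //.
  by rewrite leNgt; apply/negP => /hmin; rewrite ltnn.
have kL : (0 < k0 + L)%N by lia.
by rewrite ler_pdivrMr ?ltr0n // ler_peMr ?ler1n // ltW.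
Qed.

Lemma geometric_tail_sum (R : realFieldType) (k0 k : nat) : (k0 <= k)%N ->
  \sum_(j < k) (if (k0 <= j)%N then 2 * 2 ^- j else 0) =
  4 * 2 ^- k0 - 4 * 2 ^- k :> R.
Proof.
move=> /subnK <-; elim: (k - k0)%N => [|i IH].
  by rewrite big1 ?subrr // => j _; rewrite leqNgt ltn_ord.
rewrite addSn big_ord_recr /= IH leq_addl exprS invfM.
by field; rewrite !expf_neq0 ?pnatr_eq0.
Qed.

(** * Coverings by prefix-free families of intervals *)

Section Covering.
Variables (R : realType) (mu : probability Omega R).

Lemma prefix_mkseq (y : seq bool) (w : nat -> bool) n :
  prefix y (mkseq w n) = (size y <= n)%N && (y == mkseq w (size y)).
Proof.
rewrite prefixE /mkseq -map_take take_iota eq_sym.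
have [//|yn] := leqP (size y) n; apply/eqP => E.
by move: yn; rewrite E size_map size_iota ltnn.
Qed.

(** Countable subadditivity: [pickle] enumerates the strings, turning the unordered sum into a
    series, with the empty set at indices that code no string of [Y]. *)
Lemma measure_cover (m : {measure set Omega -> \bar R}) (A : set Omega)
    (Y : set (seq bool)) :
  measurable A -> A `<=` \bigcup_(y in Y) cyl y ->
  (m A <= \esum_(y in Y) m (A `&` cyl y))%E.
Proof.
move=> mA AY.
pose F j := if @pickle_inv (seq bool) j is Some y then if `[< Y y >] then A `&` cyl y else set0
  else set0 : set Omega.
have mF j : measurable (F j).
  rewrite /F; case: pickle_inv => [y|]; last exact: measurable0.
  case: asboolP => _; last exact: measurable0.
  by apply: measurableI => //; exact: measurable_cyl.
have -> : (\esum_(y in Y) m (A `&` cyl y) = \sum_(j <oo) m (F j))%E.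
  rewrite nneseries_esumT // (esumID (pickle @` Y)) // setTI.
  rewrite [X in (_ + X)%E]esum1 ?adde0 => [|j [_ Yj]]; last first.
    rewrite /F; case uj: (pickle_inv j) => [y|]; rewrite ?measure0 //.
    case: asboolP => Yy; rewrite ?measure0 //.
    exfalso; apply: Yj; exists y => //.
    by have := @pickle_invK (seq bool) j; rewrite uj.
  rewrite esum_image; last by move=> x y _ _ /(pcan_inj (@pickleK_inv _)).
  by apply: eq_esum => y Yy; rewrite /F pickleK_inv asboolT.
apply: measure_sigma_subadditive => // w Aw.
have [y Yy wy] := AY w Aw; exists (pickle y) => //.
by rewrite /F pickleK_inv asboolT.
Qed.

(** The shortest prefix of a sequence that lies in [G] is minimal in [G], and two distinct minimal
    strings are incomparable. *)
Lemma minimal_prefixes (G : set (seq bool)) :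
  exists2 Y, prefix_free Y /\ Y `<=` G &
    forall (w : nat -> bool) n, G (mkseq w n) -> (\bigcup_(y in Y) cyl y) w.
Proof.
exists [set x | G x /\ forall y, prefix y x -> G y -> y = x].
  split=> [x y [Gx _] [_ minY] xy|x []//]; exact: minY.
move=> w n Gn.
have exn : exists n, `[< G (mkseq w n) >] by exists n; exact/asboolP.
case: (ex_minnP exn) => m /asboolP Gm m_min.
exists (mkseq w m); last by rewrite cyl_mkseq.
split=> // y; rewrite prefix_mkseq => /andP[ym /eqP yE] Gy.
suff -> : m = size y by [].
apply/eqP; rewrite eqn_leq ym andbT m_min //.
by apply/asboolP; rewrite -yE.
Qed.

Local Notation P := (pr mu).

Lemma pr_cellwise_le m (A B : set Omega) (c : R) :
  measurable A -> measurable B ->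
  (forall b, P (A `&` cell m b) <= c * P (B `&` cell m b)) -> P A <= c * P B.
Proof.
move=> mA mB AB; rewrite (pr_cells mu m mA) (pr_cells mu m mB) mulr_sumr.
by apply: ler_sum => b _; exact: AB.
Qed.

End Covering.

(** * Measure and density of the first hits *)

Section Divergence.
Variables (R : realType) (mu : probability Omega R).
Variables (lev : nat -> nat) (sel : nat -> nat -> bool).
Hypothesis lev_lt : forall k, (lev k < lev k.+1)%N.
Local Notation P := (pr mu).
Local Notation U k := (level_set (lev k.+1) (sel k)).
Hypothesis sel_spread : forall k c,
  `| P (U k `&` cell (lev k) c) - 2 ^- k * P (cell (lev k) c) |
    <= 2 ^- (2 * lev k + 3).
Variable k0 : nat.
Hypothesis k0_ge4 : (4 <= k0)%N.

Lemma lev_mono j k : (j <= k)%N -> (lev j <= lev k)%N.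
Proof.
move=> /subnK <-; elim: (k - j)%N => // i IH.
by rewrite addSn (leq_trans IH) // ltnW.
Qed.

(* On cells of smaller measure the additive error in [sel_spread] is not
   negligible; these cells have total measure at most 1/4. *)
Definition good k b := 2 ^- (2 * lev k + 3) <= 2 ^- k / 2 * P (cell (lev k) b).

(** Indices below [k0] are left out because their sets are too large for the union bound. *)
Definition earlier k : set Omega :=
  \bigcup_(j < k) if (k0 <= j)%N then U j else set0.

Definition fresh k : set Omega := level_set (lev k) (good k) `\` earlier k.

(** These are the sets A_k, further restricted to good cells. *)
Definition first_hit k : set Omega := U k `&` fresh k.

Lemma measurable_earlier k : measurable (earlier k).
Proof.
apply: bigcup_measurable => j _; case: ifP => _ //.
exact: measurable_level.
Qed.

Lemma measurable_fresh k : measurable (fresh k).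
Proof. by apply: measurableD; [exact: measurable_level | exact: measurable_earlier]. Qed.

Lemma measurable_first_hit k : measurable (first_hit k).
Proof. by apply: measurableI; [exact: measurable_level | exact: measurable_fresh]. Qed.

Hint Resolve measurable_fresh measurable_first_hit measurable_level
  measurable_cell measurable_earlier : core.

(** Each earlier [U j] depends only on the first [lev j.+1] bits, and [lev j.+1 <= lev k]. *)
Lemma fresh_cell k w w' : binval w (lev k) = binval w' (lev k) ->
  fresh k w -> fresh k w'.
Proof.
move=> ww' [gw nw]; split; first by rewrite /level_set /= -ww'.
move=> [j /= jk]; case: ifP => // k0j Uw'; apply: nw; exists j => //; rewrite k0j.
by rewrite /level_set /= (binval_agree (lev_mono jk) ww').
Qed.

Lemma first_hit_disjoint i j w : (k0 <= i)%N -> (k0 <= j)%N ->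
  first_hit i w -> first_hit j w -> i = j.
Proof.
have aux i' j' : (k0 <= i')%N -> (i' < j')%N -> first_hit i' w -> ~ first_hit j' w.
  by move=> k0i ij [Uw _] [_ [_ nw]]; apply: nw; exists i' => //; rewrite k0i.
move=> k0i k0j hi hj; case: (ltngtP i j) => // ij; exfalso.
  exact: aux k0i ij hi hj.
exact: aux k0j ij hj hi.
Qed.

(** A cell of length [lev k] that meets the first hits is good, so the additive error there is at
    most half the main term and the density stays below 2 * 2^-k. *)
Lemma first_hit_le k n b : (n <= lev k)%N ->
  P (first_hit k `&` cell n b) <= 2 * 2 ^- k * P (cell n b).
Proof.
move=> nk; apply: (@pr_cellwise_le _ _ (lev k)) => // [|c].
  exact: measurableI.
have [/set0P[w [[[_ Ew] wb] wc]]|E0] := 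
    boolP (first_hit k `&` cell n b `&` cell (lev k) c != set0); last first.
  rewrite (eqP (negbNE E0)) pr_set0 !mulr_ge0 ?pr_ge0 ?invr_ge0 ?exprn_ge0 //.
have -> : cell n b `&` cell (lev k) c = cell (lev k) c.
  apply/seteqP; split=> [u []//|u uc]; split=> //.
  by rewrite -wb; apply: binval_agree nk _; rewrite (uc : binval _ _ = _).
apply: (@le_trans _ _ (P (U k `&` cell (lev k) c))).
  by apply: pr_le => [||u [[[Uu _] _] uc]]; [do 2 apply: measurableI => // |
    exact: measurableI | split].
have := sel_spread k c; rewrite ler_distl => /andP[_].
have : good k c by rewrite -(wc : binval w (lev k) = c); case: Ew.
have : 0 <= 2 ^- (2 * lev k + 3) :> R by rewrite invr_ge0 exprn_ge0.
by rewrite /good; lra.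
Qed.

(** Bad cells and earlier sets each take at most a quarter of the space. On the remaining half, a
    union of good cells, [U k] has density at least 2^-k / 2. *)
Lemma first_hit_ge k : (k0 <= k)%N -> 2 ^- k / 4 <= P (first_hit k).
Proof.
move=> k0k.
have c0 : 0 < 2 * 2 ^+ k :> R by rewrite mulr_gt0 ?exprn_gt0.
have c0E : 2 * 2 ^+ k * (2 ^- k / 2) = 1 :> R.
  by field; rewrite expf_neq0 ?pnatr_eq0.
(* There are 2^(lev k) cells, and a bad one has measure below 2 * 2^k * 2^-(2 lev k + 3); the total
   is at most 2^(k - lev k - 2). *)
have bad_small : P (level_set (lev k) (predC (good k))) <= 1 / 4.
  rewrite (pr_cells mu (lev k)) //.
  apply: (@le_trans _ _ (\sum_(b < 2 ^ lev k) 2 * 2 ^+ k * 2 ^- (2 * lev k + 3))).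
    apply: ler_sum => b _; have [gb|gb] := boolP (good k b).
      rewrite (_ : _ `&` _ = set0) ?pr_set0 ?mulr_ge0 ?invr_ge0 ?exprn_ge0 //.
      apply/seteqP; split=> // w [+ wb].
      by rewrite /level_set /= (wb : binval w (lev k) = b) gb.
    apply: le_trans (_ : P (cell (lev k) b) <= _).
      by apply: pr_le => [||u []] //; exact: measurableI.
    move: gb; rewrite /good -ltNge => /ltW; rewrite -(ler_pM2l c0).
    by rewrite mulrA c0E mul1r.
  rewrite sumr_const card_ord -[leLHS]mulr_natl natrX.
  rewrite mulrA ler_pdivrMr ?exprn_gt0 // mulrCA -exprD mulrAC mul1r.
  rewrite ler_pdivlMr // -[4]/(2 ^+ 2)%:R.
  have -> : 4 = 2 ^+ 2 :> R by rewrite -natrX.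
  rewrite mulrC mulrA -exprSr -exprD ler_weXn2l ?ler1n //.
  by have := leq_lev lev_lt k; lia.
(* The sets from [k0] on sum to at most 4 * 2^-k0, and [k0] is at least 4. *)
have earlier_small : P (earlier k) <= 1 / 4.
  apply: le_trans (pr_bigcup_le _ _ _) _ => [j|].
    by case: ifP.
  apply: (@le_trans _ _ (\sum_(j < k) if (k0 <= j)%N then 2 * 2 ^- j else 0)).
    apply: ler_sum => j _; case: ifP => _; rewrite ?pr_set0 //.
    exact: sparse_small.
  rewrite geometric_tail_sum //.
  have : 2 ^- k0 <= 2 ^- 4 :> R.
    by rewrite lef_pV2 ?posrE ?exprn_gt0 // ler_weXn2l // ler1n.
  have : 0 <= 2 ^- k :> R by rewrite invr_ge0 exprn_ge0.
  have -> : 2 ^- 4 = 1 / 16 :> R by rewrite -natrX div1r.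
  lra.
have half : 1 / 2 <= P (fresh k).
  have : P setT <= P (fresh k) + P (level_set (lev k) (predC (good k))) + P (earlier k).
    apply: (@le_trans _ _ (P (fresh k `|` level_set (lev k) (predC (good k))
      `|` earlier k))).
      apply: pr_le => // [|w _]; first by do ?apply: measurableU.
      have [we|we] := pselect (earlier k w); first by right.
      left; case: (boolP (good k (binval w (lev k)))) => gw; first by left.
      by right.
    apply: le_trans (pr_leU _ _ _) _ => //; first exact: measurableU.
    by rewrite lerD2r; exact: pr_leU.
  by rewrite pr_setT; lra.
apply: le_trans (_ : 2 ^- k / 2 * P (fresh k) <= _).
  have : 0 <= 2 ^- k :> R by rewrite invr_ge0 exprn_ge0.
  by nra.
rewrite -(ler_pM2l c0) mulrA c0E mul1r.
apply: (@pr_cellwise_le _ _ (lev k)) => // b.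
have [/set0P[w [Ew wb]]|E0] := boolP (fresh k `&` cell (lev k) b != set0); last first.
  by rewrite (eqP (negbNE E0)) pr_set0 mulr_ge0 ?pr_ge0 ?ltW.
have cellE : cell (lev k) b `<=` fresh k.
  move=> u ub; apply: fresh_cell Ew.
  by rewrite (wb : binval _ _ = _) (ub : binval _ _ = _).
rewrite (setIidr cellE) /first_hit -setIA (setIidr cellE).
have : good k b by rewrite -(wb : binval w (lev k) = b); case: Ew.
have := sel_spread k b; rewrite ler_distl => /andP[+ _].
rewrite /good => h1 h2.
have h : 2 ^- k / 2 * P (cell (lev k) b) <= P (U k `&` cell (lev k) b) by lra.
by rewrite -(ler_pM2l c0) mulrA c0E mul1r in h.
Qed.

End Divergence.

Lemma le_sqrn_exp2 (k : nat) : (4 <= k)%N -> (k * k <= 2 ^ k)%N.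
Proof.
move=> /subnK <-; elim: (k - 4)%N => // i IH.
by rewrite addSn expnS; nia.
Qed.

(** * A sequence on which the semimeasure stays small *)

Section Undominated.
Variables (R : realType) (mu : probability Omega R).
Variables (lev : nat -> nat) (sel : nat -> nat -> bool).
Hypothesis lev_lt : forall k, (lev k < lev k.+1)%N.
Local Notation P := (pr mu).
Local Notation U k := (level_set (lev k.+1) (sel k)).
Hypothesis sel_spread : forall k c,
  `| P (U k `&` cell (lev k) c) - 2 ^- k * P (cell (lev k) c) |
    <= 2 ^- (2 * lev k + 3).
Variables (a : seq bool -> R) (N : set Omega) (kappa : R) (k1 : nat).
Hypothesis a_ge0 : forall x, 0 <= a x.
Hypothesis a_sum : forall S, prefix_free S -> (\esum_(x in S) (a x)%:E <= 1)%E.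
Hypothesis kappa_gt0 : 0 < kappa.

(** This is lam_k; its logarithm k - log k + log kappa matches d - log d for a deficiency d of about
    k. *)
Definition payoff k : R := kappa * 2 ^+ k / k%:R.

Lemma payoff_mono i j : (0 < i)%N -> (i <= j)%N -> payoff i <= payoff j.
Proof.
move=> i0 /subnK <-; elim: (j - i)%N => // d IH; apply: le_trans IH _.
rewrite addSn /payoff; set k := (d + i)%N; have k0 : (0 < k)%N by lia.
rewrite -!mulrA ler_pM2l // ler_pdivrMr ?ltr0n // mulrAC ler_pdivlMr ?ltr0n //.
rewrite exprS mulrAC [leRHS]mulrC ler_pM2l ?exprn_gt0 // -natrM ler_nat; lia.
Qed.

Lemma payoff_large (M : R) : exists2 k0, (4 <= k0)%N /\ (k1 <= k0)%N &
  M <= payoff k0.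
Proof.
pose k0 := maxn (maxn 4 k1) (Num.bound (M / kappa)); exists k0.
  by rewrite /k0; split; lia.
have k04 : (4 <= k0)%N by rewrite /k0; lia.
rewrite /payoff -mulrA -ler_pdivrMl // mulrC.
apply: (@le_trans _ _ k0%:R).
  have [M0|M0] := leP (M / kappa) 0; first exact: le_trans M0 (ler0n _ _).
  apply: le_trans (ltW (archi_boundP (ltW M0))) _.
  by rewrite ler_nat /k0 leq_maxr.
rewrite ler_pdivlMr ?ltr0n; last by lia.
by rewrite -natrM -natrX ler_nat le_sqrn_exp2.
Qed.

Hypothesis N_measurable : measurable N.
Hypothesis N_null : mu N = 0%E.

(** The null set [N] will consist of the sequences where the test is infinite; avoiding it keeps the
    deficiency of [w] finite. *)
Lemma undominated :
  exists k (w : Omega), [/\ (k1 <= k)%N, U k w, ~ N w &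
    forall n, a (mkseq w n) < payoff k * P (cell n (binval w n))].
Proof.
apply: contrapT => H.
have dom k w : (k1 <= k)%N -> U k w -> ~ N w ->
    exists n, payoff k * P (cell n (binval w n)) <= a (mkseq w n).
  move=> k1k Uw Nw; apply: contrapT => /forallNP Hn; apply: H; exists k, w.
  by split=> // n; rewrite ltNge; apply/negP.
(* The bound is 2 (8 + kappa), so that twice the harmonic sum [S] stays below every payoff used. *)
have [k0 [k04 k10] Mk0] := payoff_large (16 + 2 * kappa).
have [L /andP[S8 S_le]] := harmonic_tail_sum (M := 8) kappa_gt0 ltac:(lra)
  (ltnW (ltnW (ltnW k04))).
set S := \sum_(i < L) _ in S8 S_le.
pose l i := payoff (k0 + i); pose A i := first_hit mu lev sel k0 (k0 + i).
have mA i : measurable (A i) by exact: measurable_first_hit.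
have l0 i : 0 <= l i by rewrite /l /payoff divr_ge0 ?mulr_ge0 ?exprn_ge0 // ltW.
have t0 j : 0 <= kappa / (k0 + j)%:R by rewrite divr_ge0 // ltW.
(* The integral of g over [X]. *)
pose nu X := \sum_(i < L) l i * P (A i `&` X).
have nu_le i w n : (i < L)%N -> A i w ->
    l i * P (cell n (binval w n)) <= a (mkseq w n) ->
    nu (cell n (binval w n)) <= 2 * a (mkseq w n).
  move=> iL Aiw li; set c := cell _ _ in li *.
  have mc : measurable c by exact: measurable_cell.
  have t1 j : 0 <= 2 * (kappa / (k0 + j)%:R) * P c.
    by rewrite mulr_ge0 ?pr_ge0 // mulr_ge0.
  apply: (@le_trans _ _ (\sum_(j < L) (l i * P (A j `&` c) +
      2 * (kappa / (k0 + j)%:R) * P c))).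
    apply: ler_sum => j _.
    have [ji|ij] := leqP j i.
      apply: ler_wpDr; first exact: t1.
      rewrite ler_wpM2r ?pr_ge0 // payoff_mono ?leq_add2l //; lia.
    apply: ler_wpDl; first by rewrite mulr_ge0 ?pr_ge0.
    (* With K = k0 + j, the density bound 2 * 2^-K times the payoff is 2 kappa / K. *)
    have [nk|kn] := leqP n (lev (k0 + j)).
      apply: le_trans (ler_wpM2l (l0 j) (first_hit_le sel_spread k0 _ nk)) _.
      rewrite -/c [leLHS]mulrA ler_wpM2r ?pr_ge0 // /l /payoff.
      rewrite le_eqVlt; apply/orP; left; apply/eqP; field.
      by rewrite -natrD pnatr_eq0 expf_neq0 ?pnatr_eq0 // andbT; lia.
    (* a long prefix of [w] already lies in [U (k0 + i)], hence misses [A j] *)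
    have -> : A j `&` c = set0; last first.
      by rewrite pr_set0 mulr0 t1.
    apply/seteqP; split=> // u [[_ [_ nu']] uc]; apply: nu'.
    exists (k0 + i)%N; rewrite /= ?ltn_add2l // leq_addr.
    case: Aiw => Uw _; move: Uw; rewrite /level_set /=.
    rewrite (binval_agree (w := u) (w' := w) (m := n)) //.
    apply: leq_trans (ltnW kn); apply: lev_mono => //; lia.
  rewrite big_split /= -mulr_suml -[X in X + _]mulr_sumr
    -[X in _ + X * _]mulr_sumr -/S.
  have dis : \sum_(j < L) P (A j `&` c) <= P c.
    rewrite -(@pr_bigcup_ord _ _ _ (fun j => A j `&` c)).
    - apply: pr_le => //; last by move=> u [j _ []].
      by apply: bigcup_measurable => j _; exact: measurableI.
    - by move=> j; exact: measurableI.
    - move=> j j' _ _ [u [[Aj _] [Aj' _]]].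
      have := first_hit_disjoint (leq_addr _ _) (leq_addr _ _) Aj Aj'; lia.
  have lk0 : payoff k0 <= l i by apply: payoff_mono; rewrite ?leq_addr //; lia.
  have Pc := pr_ge0 mu c.
  have h1 : l i * \sum_(j < L) P (A j `&` c) <= l i * P c by rewrite ler_wpM2l.
  have h2 : 2 * S * P c <= l i * P c.
    rewrite ler_wpM2r //; apply: le_trans lk0; apply: le_trans Mk0.
    by move: S_le; clearbody S; lra.
  by rewrite -/c in li; lra.
have [Y [pfY YG] cover] := minimal_prefixes [set x | nu (cyl x) <= 2 * a x].
have ANY i : (i < L)%N -> A i `\` N `<=` \bigcup_(y in Y) cyl y.
  move=> iL w [Aw Nw].
  have [n hn] : exists n, l i * P (cell n (binval w n)) <= a (mkseq w n).
    by apply: dom => //; [lia | case: Aw].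
  by apply: (cover w n); rewrite /= cyl_mkseq; exact: nu_le hn.
have muA (i : 'I_L) : ((l i)%:E * mu (A i) <=
    \esum_(y in Y) ((l i)%:E * mu (A i `&` cyl y)))%E.
  have -> : mu (A i) = mu (A i `\` N).
    rewrite (measureDI _ (mA i) N_measurable) -[RHS]adde0; congr (_ + _)%E.
    apply/eqP; rewrite eq_le measure_ge0 andbT -N_null le_measure ?inE //.
    exact: measurableI.
  (* Covering with the rescaled measure places the factor [l i] inside the sum. *)
  apply: le_trans (measure_cover (mscale (NngNum (l0 i)) mu) _ (ANY i (ltn_ord i))) _.
    exact: measurableD.
  apply: le_esum => y _; rewrite /mscale /=; apply: lee_wpmul2l => //.
  apply: le_measure; rewrite ?inE; try apply: measurableI;
    try exact: measurableD; try exact: measurable_cyl; try exact: mA.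
  by move=> u [[]].
have : (\sum_(i < L) (l i)%:E * mu (A i) <= 2%:E)%E.
  apply: le_trans (lee_sum _ (fun i _ => muA i)) _.
  rewrite -esum_sum; last by move=> y i _ _; rewrite mule_ge0 ?lee_fin.
  apply: (@le_trans _ _ (\esum_(y in Y) ((a y)%:E + (a y)%:E))%E).
    apply: le_esum => y Yy.
    have := YG _ Yy; rewrite /= /nu -lee_fin -EFinD => h.
    rewrite -[a y + a y]mulr2n -mulr_natl; apply: le_trans h.
    rewrite -sumEFin; apply: lee_sum => i _; rewrite prE ?EFinM //.
    by apply: measurableI => //; exact: measurable_cyl.
  (* The factor 2 is written as two copies of [a], each of total at most 1 on the prefix-free
     [Y]. *)
  rewrite esumD; try by move=> y _; rewrite lee_fin.
  rewrite (_ : 2 = 1 + 1) // EFinD; apply: leeD; exact: a_sum.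
rewrite leNgt => /negP; apply.
(* Each term contributes at least kappa / (4 (k0 + i)), and S > 8 makes the total exceed 2. *)
apply: (@lt_le_trans _ _ (S / 4)%:E); first by rewrite lte_fin; lra.
rewrite /S mulr_suml -sumEFin; apply: lee_sum => i _.
rewrite prE // -EFinM lee_fin.
apply: le_trans (ler_wpM2l (l0 i) (first_hit_ge lev_lt sel_spread k04 (leq_addr i k0))).
rewrite /l /payoff le_eqVlt; apply/orP; left; apply/eqP; field.
by rewrite -natrD expf_neq0 ?pnatr_eq0 //=; lia.
Qed.

End Undominated.

(** * The deficiencies *)

(* From the tangent line of ln at v0 / b, whose slope is at most b. *)
Lemma sub_log_mono (R : realType) (b v0 v k : R) :
  0 < b -> 1 <= v0 -> v0 <= v -> v0 / b <= k ->
  v0 / b - ln k / b <= v / b - ln (v / b) / b.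
Proof.
move=> b0 v01 v0v v0k.
have v00 : 0 < v0 by lra.
have u0 : 0 < v0 / b by rewrite divr_gt0.
have k0 : 0 < k by exact: lt_le_trans v0k.
have v_gt0 : 0 < v by lra.
have lnk : ln (v0 / b) <= ln k by rewrite ler_ln ?posrE.
have lnv : ln (v / b) <= ln (v0 / b) + (v - v0) / v0.
  have -> : v / b = v0 / b * (1 + (v - v0) / v0).
    by field; rewrite !gt_eqF.
  have q0 : 0 <= (v - v0) / v0 by rewrite divr_ge0 ?subr_ge0 // ltW.
  by rewrite lnM ?posrE ?ltr_wpDr // lerD2l le_ln1Dx //; lra.
have q : (v - v0) / v0 <= v - v0 by rewrite ler_pdivrMr // ler_peMr // subr_ge0.
by rewrite -!mulrBl ler_pM2r ?invr_gt0 //; lra.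
Qed.

(** * Sequences of infinite deficiency *)

Section Null.
Variables (R : realType) (mu : probability Omega R) (t : Omega -> \bar R).
Hypothesis t_pb : pb_test mu t.

Lemma measurable_pb_gt (n : nat) :
  measurable ([set w | (n%:R%:E < t w)%E] : set Omega).
Proof.
have [_ [e _ eE] _] := t_pb.
have := eE n 0%N 0%N; rewrite ratr_ratn subr0 divr1 => ->.
rewrite bigcup_mkcond.
have := @bigcupT_measurable _ Omega (fun j => if @pickle_inv (seq bool) j is Some x
  then if x \in [set x | exists i, e [tuple n; 0%N; 0%N; i] = (str_code x).+1]
       then cyl x else set0 else set0).
set F := (X in \bigcup_i X i) => mF.
rewrite (_ : \bigcup_x _ = \bigcup_j F j).
  apply: mF => j; case: pickle_inv => [x|]; last exact: measurable0.
  by case: ifP => _; [exact: measurable_cyl | exact: measurable0].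
apply/seteqP; split=> [w [x _ wx]|w [j _]].
  by exists (pickle x) => //; rewrite /F pickleK_inv.
by rewrite /F; case: pickle_inv => // x wx; exists x.
Qed.

(** The set is the intersection of the sets where [t] exceeds n, and these have measure at most 1 /
    n. *)
Lemma pb_infinite_null :
  measurable ([set w | t w = +oo%E] : set Omega) /\ mu [set w | t w = +oo%E] = 0%E.
Proof.
set N := [set w | _].
have NE : N = \bigcap_n [set w | (n%:R%:E < t w)%E].
  apply/seteqP; split=> [w tw n _|w wn].
    by rewrite /= (tw : t w = +oo%E) ltry.
  have [t0 _ _] := t_pb; have := t0 w.
  rewrite /N /=; case E: (t w) => [r| |] //; rewrite lee_fin => r0.
  have := wn (Num.bound r) I; rewrite /= E lte_fin ltNge.
  by rewrite ltW // archi_boundP.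
have mN : measurable N.
  by rewrite NE; apply: bigcapT_measurable => n; exact: measurable_pb_gt.
split=> //; apply/eqP; rewrite eq_le measure_ge0 andbT.
apply/lee_addgt0Pr => e e0; rewrite add0e.
pose n := (Num.bound e^-1).+1.
have [_ _ /(_ n%:R)] := t_pb; rewrite ltr0n => /(_ isT); rewrite ratr_nat.
rewrite fmorphV /= ratr_nat => h; apply: le_trans (le_trans _ h) _.
- apply: le_measure; rewrite ?inE //; first exact: measurable_pb_gt.
  by rewrite NE => w; apply.
- rewrite lee_fin -[e]invrK lef_pV2 ?posrE ?invr_gt0 ?ltr0n //.
  apply: ltW; apply: lt_trans (archi_boundP _) _; first by rewrite invr_ge0 ltW.
  by rewrite ltr_nat.
Qed.

End Null.

Local Open Scope ereal_scope.

Lemma elog2_EFin (R : realType) (x : R) : (0 < x)%R ->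
  elog2 x%:E = (ln x / ln 2)%:E.
Proof. by move=> x0; rewrite /elog2 lne_EFin. Qed.

(** A prefix with [a] equal to 0 contributes minus infinity. Otherwise the strict bound forces its
    measure and [lam] to be positive, and logarithms may be taken. *)
Lemma dA_le (R : realType) (mu : probability Omega R) (a : seq bool -> R)
    (w : Omega) (lam : R) : (forall x, 0 <= a x)%R ->
  (forall n, a (mkseq w n) < lam * pr mu (cell n (binval w n)))%R ->
  dA mu a w <= (ln lam / ln 2)%:E.
Proof.
move=> a0 aw; apply: ge_ereal_sup => _ [n _ <-].
have ln20 : (0 < ln 2 :> R)%R by rewrite ln_gt0 // ltr1n.
rewrite /KA oppeK cyl_mkseq prE; last exact: measurable_cell.
have := aw n; have := a0 (mkseq w n).
set p := pr _ _; set x := a _; rewrite [(0 <= x)%R]le_eqVlt => /orP[/eqP <- _|x0 xp].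
  by rewrite [X in _ + X]/elog2 /= lexx mulNyr gtr0_sg ?invr_gt0 // mul1e addeNy leNye.
have p0 : (0 < p)%R.
  rewrite lt_neqAle pr_ge0 andbT; apply/eqP => p0.
  by move: xp; rewrite -p0 mulr0 ltNge ltW.
have lam0 : (0 < lam)%R.
  by rewrite -(pmulr_lgt0 _ p0); exact: lt_trans xp.
rewrite !elog2_EFin // -EFinN -EFinD lee_fin addrC -mulrBl.
rewrite ler_pM2r ?invr_gt0 // lerBlDr -lnM ?posrE // ler_ln ?posrE ?mulr_gt0 //.
exact: ltW.
Qed.

(** The bounds on [dP tP w] make its logarithm a genuine real number, so the strict inequality does
    not rest on conventions for infinite values. *)
Theorem theorem2 (R : realType) (mu : probability Omega R)
    (tP : Omega -> \bar R) (a : seq bool -> R)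
    (mu_computable : computable_measure mu) (mu_non_atomic : non_atomic mu)
    (tP_maximal : maximal_pb_test mu tP) (a_universal : universal_semimeasure a)
    (c : R) :
  exists w : Omega,
    [/\ 0 < dP tP w, dP tP w < +oo &
        dA mu a w < dP tP w - elog2 (dP tP w) - c%:E].
Proof.
have [lev [sel [levR selR lev_lt spread]]] := sparse_sets mu_computable mu_non_atomic.
have [tP_pb /(_ _ (pb_sparse_test levR selR lev_lt spread))[C C0 tC]] := tP_maximal.
have [[a0 _ a_sum] _] := a_universal.
have [mN N0] := pb_infinite_null tP_pb.
(* Raising the constant to at least 1 makes [ln (4 * C1)] nonnegative, hence [v0 / b <= k] below. *)
pose C1 : R := Num.max C 1%R.
have C11 : (1 <= C1)%R by rewrite le_max lexx orbT.
have C10 : (0 < C1)%R by exact: lt_le_trans C11.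
have C40 : (0 < 4 * C1)%R by rewrite mulr_gt0.
pose b : R := ln 2; have b0 : (0 < b)%R by rewrite ln_gt0 // ltr1n.
have lnC0 : (0 <= ln (4 * C1))%R by rewrite ln_ge0 //; lra.
(* Chosen so that [ln (payoff kappa k)] equals v0 - ln k - (c + 1) b; the extra 1 gives the strict
   inequality. *)
pose kappa := (expR (- (c + 1) * b) / (4 * C1))%R.
have kappa0 : (0 < kappa)%R by rewrite divr_gt0 ?expR_gt0.
(* From this index on, [v0] is at least 1. *)
pose k1 := (Num.bound ((1 + ln (4 * C1)) / b)).+1.
have [k [w [k1k Uw Nw aw]]] :=
  undominated lev_lt spread k1 a0 a_sum kappa0 mN N0.
(* A lower bound, in natural logarithm, for the maximal test on [U_k]. *)
pose v0 := (k%:R * b - ln (4 * C1))%R.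
have v01 : (1 <= v0)%R.
  rewrite /v0 lerBrDr -ler_pdivrMr //.
  apply: ltW; apply: lt_le_trans (archi_boundP _) _.
    by rewrite divr_ge0 ?addr_ge0 // ltW.
  by rewrite ler_nat ltnW.
have k0 : (0 < k%:R :> R)%R by rewrite ltr0n (leq_trans _ k1k).
have [t0 _ _] := tP_pb.
have tw : tP w = (fine (tP w))%:E.
  by rewrite fineK // ge0_fin_numE // ltey; apply/eqP.
set s := fine _ in tw.
have s_ge : (2 ^+ k / (4 * C1) <= s)%R.
  have := le_trans (sparse_test_ge R Uw) (tC w); rewrite tw -EFinM lee_fin => h.
  have s0 : (0 <= s)%R by rewrite -lee_fin -tw.
  rewrite invfM mulrA ler_pdivrMr //; apply: le_trans h _.
  by rewrite mulrC ler_wpM2l // le_max lexx.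
have s0 : (0 < s)%R by apply: lt_le_trans s_ge; rewrite divr_gt0 ?exprn_gt0.
have v0s : (v0 <= ln s)%R.
  have := s_ge; rewrite -ler_ln ?posrE ?divr_gt0 ?exprn_gt0 //.
  by rewrite ln_div ?posrE ?exprn_gt0 // lnXn // -[(ln 2 *+ k)%R]mulr_natl.
have u0 : (0 < ln s / b)%R by rewrite divr_gt0 //; lra.
exists w; rewrite /dP tw elog2_EFin // -/b; split.
- by rewrite lte_fin.
- by rewrite ltry.
rewrite elog2_EFin // -/b -!EFinB; apply: le_lt_trans (dA_le a0 aw) _.
have lam : ln (payoff kappa k) = (v0 - ln k%:R - (c + 1) * b)%R.
  have p2 : (0 < 2 ^+ k :> R)%R by rewrite exprn_gt0.
  rewrite /payoff ln_div ?posrE //; last exact: (mulr_gt0 kappa0 p2).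
  rewrite lnM ?posrE ?exprn_gt0 // /kappa ln_div ?posrE ?expR_gt0 // expRK lnXn // -[(ln 2 *+ k)%R]mulr_natl -/b /v0.
  ring.
have v0k : (v0 / b <= k%:R)%R by rewrite ler_pdivrMr // /v0 gerDl oppr_le0.
have := sub_log_mono b0 v01 v0s v0k.
rewrite lam lte_fin -/b => h.
have -> : ((v0 - ln k%:R - (c + 1) * b) / b = v0 / b - ln k%:R / b - c - 1)%R.
  by field; rewrite gt_eqF.
lra.
Qed.
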